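(* $$\gamma_1\left(\tfrac14\right)=\tfrac12\left[2\gamma_1-7\log^2 2-6\gamma\log 2\right]-\tfrac12\pi\left[\gamma+4\log 2+3\log\pi-4\log\Gamma\left(\tfrac14\right)\right].$$
   Context: For real $u>0$, $\zeta(s,u)$ is the Hurwitz zeta function (the meromorphic continuation in $s$ of $\sum_{n\ge 0}(n+u)^{-s}$). The generalised Stieltjes constants $\gamma_p(u)$, $p\ge 0$, are defined by the Laurent expansion about $s=1$: $\zeta(s,u)=\frac{1}{s-1}+\sum_{p=0}^\infty\frac{(-1)^p}{p!}\gamma_p(u)(s-1)^p$, and $\gamma_p=\gamma_p(1)$. $\gamma$ (no subscript) is Euler's constant, $\Gamma$ the gamma function and $\log$ the natural logarithm. *)

(* Defs.v *)
(* Standard library reals, with Coquelicot for complex numbers, limits,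
   series and integrals. *)
From Stdlib Require Import Reals Factorial.
From Coquelicot Require Import Coquelicot.

Local Open Scope R_scope.

(* x^z = exp (z log x), principal branch; meaningful for x > 0. *)
Definition rpowC (x : R) (z : C) : C :=
  (exp (Re z * ln x) * cos (Im z * ln x),
   exp (Re z * ln x) * sin (Im z * ln x)).

(* Near every point z0, (z - z0)^n f(z) coincides off z0 with a function h
   holomorphic near z0. The values of f at isolated points, in particular at
   its poles, are unconstrained. *)
Definition meromorphic (f : C -> C) : Prop :=
  forall z0 : C, exists (n : nat) (h : C -> C) (r : R),
    0 < r /\
    (forall z : C, Cmod (z - z0) < r ->
       ex_derive (K := C_AbsRing) (V := C_NormedModule) h z) /\
    (forall z : C, 0 < Cmod (z - z0) < r -> ((z - z0) ^ n * f z)%C = h z).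

(* By the identity theorem this determines Z off a set of isolated points. *)
Definition is_hurwitz_zeta (u : R) (Z : C -> C) : Prop :=
  meromorphic Z /\
  (forall s : C, 1 < Re s ->
     is_series (K := C_AbsRing) (V := C_NormedModule)
       (fun n : nat => rpowC (INR n + u) (- s)) (Z s)).

(* Laurent expansion of Z about s = 1, with principal part 1 / (s - 1). *)
Definition is_stieltjes (Z : C -> C) (g : nat -> R) : Prop :=
  exists r : R, 0 < r /\
    forall s : C, 0 < Cmod (s - 1) < r ->
      is_pseries (K := C_AbsRing) (V := C_NormedModule)
        (fun p : nat => RtoC ((-1) ^ p / INR (fact p) * g p))
        (s - 1)%C (Z s - 1 / (s - 1))%C.

Definition euler_gamma : R :=
  real (Lim_seq (fun n : nat => sum_n_m (fun k : nat => / INR k) 1 n - ln (INR n))).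

(* Euler's integral, improper at both ends; meaningful for x > 0. *)
Definition Gamma (x : R) : R :=
  RInt_gen (fun t : R => Rpower t (x - 1) * exp (- t))
    (at_right 0) (Rbar_locally p_infty).

(* Main.v *)
Require Import Defs.
From Stdlib Require Import Reals Factorial Lra Lia Psatz.
From Coquelicot Require Import Coquelicot.
Open Scope R_scope.

(* Only real s = 1 + e with e -> 0+ matter.  Splitting the positive integers
   by residue mod 4 gives 2 zeta(s, 1/4) = (4^s - 2^s) zeta(s) + 4^s beta(s)
   with beta(s) = sum (-1)^n (2n+1)^-s, so comparing the coefficients of s - 1
   reduces the claim to the value of
     S = - beta'(1) = sum (-1)^n ln(2n+1) / (2n+1).

   Put O(n) = sum_{j<n} 1/(2j+1) = int_0^{pi/2} (1 - cos 2nv) / (2 sin v) dv,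
   which is (ln n)/2 + ln 2 + gamma/2 + O(1/n).  For fixed K,
     sum (-1)^n / (2n+1) O(2K(2n+1))
       = int_0^{pi/2} [sum (-1)^n / (2n+1) (1 - cos((2n+1) 4Kv))] / (2 sin v) dv,
   and the bracket is a square wave with values 0 and pi/2.  The integral is
   therefore pi/4 times a sum of logarithms of quotients of tangents.  As
   K -> oo this yields
     S = (pi/2) D - (pi/4) (gamma + ln(2 pi)),
     D = lim sum_{k<K} ln((4k+3)/(4k+1)) - (ln K)/2,
   and D = 2 ln Gamma(1/4) - ln pi - (ln 2)/2 by Gauss's product for
   Gamma(1/4) and Wallis's product. *)

(** * Partial sums and uniformly convergent families *)

(** The series for [S] converges only conditionally, and its logarithms are reached through odd
    harmonic numbers, which are integrals of cosines and agree with half a logarithm plus a constant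
    up to [O(1/n)]. At the argument [2K(2n+1)] that error drops to [O(1/(K(2n+1)))]; the weight
    [1/(2n+1)] then makes the errors absolutely summable, with total [O(1/K)]. This is why a whole
    family of identities indexed by [K] is needed. The even factor [2K] lets the range of [v] hold
    exactly [K] periods of the wave, so that each period contributes one quotient of tangents.

    The obstacle is the exchange of sum and integral: the partial sums of the wave converge
    non-uniformly at its jumps (Gibbs), and the cosecant is singular at [v = 0]. Two bounds take the
    place of dominated convergence: one uniform in the number of terms and linear in [t], and one
    decaying like [1/N] away from the jumps. On the zeta side the derivative of beta at 1 is a
    one-sided limit of difference quotients; pairing consecutive terms gives the uniform tails that
    allow this limit under the sum. *)

Fixpoint psum (f : nat -> R) (N : nat) : R :=
  match N with O => 0 | S n => psum f n + f n end.

Lemma psum_ext_lt (f g : nat -> R) (N : nat) :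
  (forall n, (n < N)%nat -> f n = g n) -> psum f N = psum g N.
Proof.
induction N as [|N IH]; simpl; intros H; [reflexivity|].
rewrite IH, H; auto with arith.
Qed.

Lemma psum_ext (f g : nat -> R) (N : nat) :
  (forall n, f n = g n) -> psum f N = psum g N.
Proof. intros H; apply psum_ext_lt; auto. Qed.

Lemma psum_plus (f g : nat -> R) (N : nat) :
  psum (fun n => f n + g n) N = psum f N + psum g N.
Proof. induction N as [|N IH]; simpl; [|rewrite IH]; ring. Qed.

Lemma psum_minus (f g : nat -> R) (N : nat) :
  psum (fun n => f n - g n) N = psum f N - psum g N.
Proof. induction N as [|N IH]; simpl; [|rewrite IH]; ring. Qed.

Lemma psum_scal (c : R) (f : nat -> R) (N : nat) :
  psum (fun n => c * f n) N = c * psum f N.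
Proof. induction N as [|N IH]; simpl; [|rewrite IH]; ring. Qed.

Lemma psum_abs_le (f g : nat -> R) (N : nat) :
  (forall n, Rabs (f n) <= g n) -> Rabs (psum f N) <= psum g N.
Proof.
intros H; induction N as [|N IH]; simpl; [rewrite Rabs_R0; lra|].
eapply Rle_trans; [apply Rabs_triang|]; specialize (H N); lra.
Qed.

Lemma psum_sum_n (f : nat -> R) (N : nat) : sum_n f N = psum f (S N).
Proof.
induction N as [|N IH].
- rewrite sum_O; simpl; ring.
- rewrite sum_Sn, IH; reflexivity.
Qed.

Lemma psum_double (f : nat -> R) (N : nat) :
  psum f (2 * N) = psum (fun k => f (2 * k)%nat + f (2 * k + 1)%nat) N.
Proof.
induction N as [|N IH]; [reflexivity|].
replace (2 * S N)%nat with (S (S (2 * N))) by lia.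
cbn [psum]; rewrite IH; replace (2 * N + 1)%nat with (S (2 * N)) by lia; ring.
Qed.

Lemma is_series_psum (f : nat -> R) (l : R) :
  is_series f l <-> is_lim_seq (psum f) l.
Proof.
split; intros H.
- apply is_lim_seq_incr_1.
  apply is_lim_seq_ext with (sum_n f); [apply psum_sum_n | exact H].
- apply is_lim_seq_incr_1 in H.
  apply (is_lim_seq_ext _ (sum_n f)) in H; [exact H|].
  intros n; symmetry; apply psum_sum_n.
Qed.

Lemma filterlim_Rplus {F : (R -> Prop) -> Prop} {FF : Filter F} (f g : R -> R) (a b : R) :
  filterlim f F (locally a) -> filterlim g F (locally b) ->
  filterlim (fun x => f x + g x) F (locally (a + b)).
Proof.
intros Hf Hg.
eapply filterlim_comp_2; [exact Hf | exact Hg |].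
exact (@filterlim_plus _ R_NormedModule a b).
Qed.

Lemma filterlim_Rmult {F : (R -> Prop) -> Prop} {FF : Filter F} (f g : R -> R) (a b : R) :
  filterlim f F (locally a) -> filterlim g F (locally b) ->
  filterlim (fun x => f x * g x) F (locally (a * b)).
Proof.
intros Hf Hg.
eapply filterlim_comp_2; [exact Hf | exact Hg |].
exact (@filterlim_mult R_AbsRing a b).
Qed.

Lemma filterlim_Rminus {F : (R -> Prop) -> Prop} {FF : Filter F} (f g : R -> R) (a b : R) :
  filterlim f F (locally a) -> filterlim g F (locally b) ->
  filterlim (fun x => f x - g x) F (locally (a - b)).
Proof.
intros Hf Hg; apply filterlim_Rplus; [exact Hf|].
eapply filterlim_comp; [exact Hg | exact (@filterlim_opp _ R_NormedModule b)].
Qed.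

(* The bound on the tails of [d n e] is uniform in [e]; it passes to the
   limits [d0 n], which makes their partial sums Cauchy. *)
Lemma tannery (d : R -> nat -> R) (d0 : nat -> R) (F : R -> R) (tau : nat -> R) :
  (forall e N M, 0 < e -> (1 <= N <= M)%nat ->
     Rabs (psum (d e) M - psum (d e) N) <= tau N) ->
  (forall e, 0 < e -> is_lim_seq (psum (d e)) (F e)) ->
  (forall n, filterlim (fun e => d e n) (at_right 0) (locally (d0 n))) ->
  is_lim_seq tau 0 ->
  exists D : R, is_lim_seq (psum d0) D /\ filterlim F (at_right 0) (locally D).
Proof.
intros Htail HF Hd Htau.
assert (Hps : forall N, filterlim (fun e => psum (d e) N) (at_right 0)
  (locally (psum d0 N))).
{ induction N as [|N IH]; simpl; [apply filterlim_const|].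
  exact (filterlim_Rplus _ _ _ _ IH (Hd N)). }
assert (Hpos : at_right 0 (fun e => 0 < e)).
{ exists (mkposreal 1 Rlt_0_1); simpl; intros; assumption. }
assert (Htail0 : forall N M, (1 <= N <= M)%nat ->
  Rabs (psum d0 M - psum d0 N) <= tau N).
{ intros N M HNM.
  assert (HL : filterlim (fun e => Rabs (psum (d e) M - psum (d e) N)) (at_right 0)
    (locally (Rabs (psum d0 M - psum d0 N)))).
  { eapply filterlim_comp; [exact (filterlim_Rminus _ _ _ _ (Hps M) (Hps N)) |].
    exact (continuous_Rabs (psum d0 M - psum d0 N)). }
  assert (HP : ProperFilter (at_right 0)) by apply at_right_proper_filter.
  refine (filterlim_le (F := at_right 0) _ (fun _ => tau N) (Finite _)
    (Finite (tau N)) _ HL (filterlim_const (tau N))).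
  apply filter_imp with (2 := Hpos); intros e He; apply Htail; assumption. }
assert (HD : ex_finite_lim_seq (psum d0)).
{ apply ex_lim_seq_cauchy_corr; intros eps.
  apply is_lim_seq_spec in Htau; destruct (Htau eps) as [N0 HN0].
  exists (S N0).
  assert (Hw : forall n m, (S N0 <= n)%nat -> (n <= m)%nat ->
    Rabs (psum d0 n - psum d0 m) < eps).
  { intros n m Hn Hnm; rewrite Rabs_minus_sym.
    eapply Rle_lt_trans; [apply Htail0; lia|].
    eapply Rle_lt_trans; [apply Rle_abs|].
    replace (tau n) with (tau n - 0) by ring; apply HN0; lia. }
  intros n m Hn Hm; destruct (Nat.le_ge_cases n m).
  - apply Hw; assumption.
  - rewrite Rabs_minus_sym; apply Hw; assumption. }
destruct HD as [D HD]; exists D; split; [exact HD|].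
assert (Hfar : forall e N, 0 < e -> (1 <= N)%nat -> Rabs (F e - psum (d e) N) <= tau N).
{ intros e N He HN.
  apply (is_lim_seq_le_loc (fun M => Rabs (psum (d e) M - psum (d e) N))
    (fun _ => tau N) (Finite (Rabs (F e - psum (d e) N))) (Finite (tau N))).
  - exists N; intros M HM; apply Htail; [exact He | lia].
  - apply (is_lim_seq_abs _ (Finite (F e - psum (d e) N))).
    apply is_lim_seq_minus'; [apply HF; exact He | apply is_lim_seq_const].
  - apply is_lim_seq_const. }
apply filterlim_locally; intros eps.
assert (He4 : 0 < eps / 4) by (destruct eps; simpl; lra).
apply is_lim_seq_spec in Htau; destruct (Htau (mkposreal _ He4)) as [N1 HN1].
apply is_lim_seq_spec in HD; destruct (HD (mkposreal _ He4)) as [N2 HN2].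
set (N := S (N1 + N2)).
assert (HN : (1 <= N)%nat) by (unfold N; lia).
specialize (HN1 N ltac:(unfold N; lia)); specialize (HN2 N ltac:(unfold N; lia)).
clearbody N; simpl in HN1, HN2.
generalize (proj1 (filterlim_locally _ _) (Hps N) (mkposreal _ He4)); intros H3.
generalize (filter_and _ _ Hpos H3); apply filter_imp; intros e [He H4].
change (Rabs (psum (d e) N - psum d0 N) < eps / 4) in H4.
change (Rabs (F e - D) < eps).
assert (H5 : Rabs (F e - psum (d e) N) <= tau N).
{ apply Hfar; [exact He | exact HN]. }
revert HN1 HN2 H4 H5; unfold Rabs; repeat destruct Rcase_abs; lra.
Qed.

(** * Partial sums of the square wave *)

Definition alt (n : nat) : R := (-1) ^ n.
Definition odd (n : nat) : R := 2 * INR n + 1.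

Lemma odd_pos n : 0 < odd n.
Proof. unfold odd; generalize (pos_INR n); lra. Qed.

Lemma alt_abs n : Rabs (alt n) = 1.
Proof. apply pow_1_abs. Qed.

Definition leibniz (N : nat) : R := psum (fun n => alt n / odd n) N.

(** Leibniz's series minus the Fourier series of a square wave; the limit is 0 for [|t| < PI/2]. The
    factor [1 - cos] is what the integral for an odd harmonic number produces. *)
Definition sqwave (N : nat) (t : R) : R :=
  psum (fun n => alt n / odd n * (1 - cos (odd n * t))) N.

Definition oddharm (n : nat) : R := psum (fun j => / odd j) n.

Lemma is_derive_psum (f : nat -> R -> R) (df : nat -> R -> R) (N : nat) (x : R) :
  (forall n, is_derive (f n) x (df n x)) ->
  is_derive (fun x => psum (fun n => f n x) N) x (psum (fun n => df n x) N).
Proof.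
intros H; induction N as [|N IH]; simpl.
- apply @is_derive_const.
- apply (is_derive_plus (V := R_NormedModule)); [exact IH | apply H].
Qed.

Lemma continuous_psum (f : nat -> R -> R) (N : nat) (x : R) :
  (forall n, continuous (f n) x) ->
  continuous (fun x => psum (fun n => f n x) N) x.
Proof.
intros H; induction N as [|N IH]; simpl.
- apply continuous_const.
- apply (continuous_plus (V := R_NormedModule)); [exact IH | apply H].
Qed.

Lemma is_RInt_psum (f : nat -> R -> R) (I : nat -> R) (a b : R) (N : nat) :
  (forall n, is_RInt (f n) a b (I n)) ->
  is_RInt (fun x => psum (fun n => f n x) N) a b (psum I N).
Proof.
intros H; induction N as [|N IH]; simpl.
- evar_last; [apply (is_RInt_const (V := R_NormedModule)) | apply Rmult_0_r].
- apply (is_RInt_plus (V := R_NormedModule)); [exact IH | apply H].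
Qed.

(** Telescopes, because [2 cos t sin((2n+1)t) = sin((2n+2)t) + sin(2nt)] and the signs alternate.
    The sum is the derivative of [sqwave N]. *)
Lemma alt_sin_kernel (N : nat) (t : R) :
  2 * cos t * psum (fun n => alt n * sin (odd n * t)) N = - alt N * sin (2 * INR N * t).
Proof.
induction N as [|N IH].
- simpl; replace (2 * 0 * t) with 0 by ring; rewrite sin_0; ring.
- cbn [psum]; rewrite Rmult_plus_distr_l, IH.
  unfold alt; rewrite <- tech_pow_Rmult, S_INR.
  replace (2 * (INR N + 1) * t) with (odd N * t + t) by (unfold odd; ring).
  replace (2 * INR N * t) with (odd N * t - t) by (unfold odd; ring).
  rewrite sin_plus, sin_minus; ring.
Qed.

(** Telescopes by [2 sin v sin((2j+1)v) = cos(2jv) - cos((2j+2)v)]. The sum of sines is a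
    division-free form of [(1 - cos(2nv)) / (2 sin v)], regular at 0. *)
Lemma sin_kernel (n : nat) (v : R) :
  2 * sin v * psum (fun j => sin (odd j * v)) n = 1 - cos (2 * INR n * v).
Proof.
induction n as [|n IH].
- simpl; replace (2 * 0 * v) with 0 by ring; rewrite cos_0; ring.
- cbn [psum]; rewrite Rmult_plus_distr_l, IH, S_INR.
  replace (2 * (INR n + 1) * v) with (odd n * v + v) by (unfold odd; ring).
  replace (2 * INR n * v) with (odd n * v - v) by (unfold odd; ring).
  rewrite cos_plus, cos_minus; ring.
Qed.

Lemma sqwave_derive (N : nat) (t : R) :
  is_derive (sqwave N) t (psum (fun n => alt n * sin (odd n * t)) N).
Proof.
unfold sqwave.
apply (is_derive_psum (fun n t => alt n / odd n * (1 - cos (odd n * t)))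
  (fun n t => alt n * sin (odd n * t))).
intros n; auto_derive; [exact I|]; field; generalize (odd_pos n); lra.
Qed.

Lemma sqwave_0 N : sqwave N 0 = 0.
Proof.
unfold sqwave; induction N as [|N IH]; cbn [psum]; [reflexivity|].
rewrite IH, Rmult_0_r, cos_0; ring.
Qed.

Lemma alt_sq n : alt n * alt n = 1.
Proof. unfold alt; rewrite <- Rpow_mult_distr; replace (-1 * -1) with 1 by ring;
  apply pow1. Qed.

Lemma cos_plus_INR_PI (n : nat) (x : R) : cos (x + INR n * PI) = alt n * cos x.
Proof.
induction n as [|n IH].
- simpl; rewrite Rmult_0_l, Rplus_0_r; unfold alt; simpl; ring.
- rewrite S_INR; unfold alt; rewrite <- tech_pow_Rmult; fold (alt n).
  replace (x + (INR n + 1) * PI) with (x + INR n * PI + PI) by ring.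
  rewrite neg_cos, IH; ring.
Qed.

Lemma odd_multiple_cos (n k : nat) (s : R) :
  cos (odd n * (s + INR k * PI)) = alt k * cos (odd n * s).
Proof.
induction k as [|k IH].
- simpl; rewrite Rmult_0_l, Rplus_0_r; unfold alt; simpl; ring.
- rewrite S_INR; unfold alt; rewrite <- tech_pow_Rmult; fold (alt k).
  replace (odd n * (s + (INR k + 1) * PI)) with
    (odd n * (s + INR k * PI) + PI + 2 * INR n * PI) by (unfold odd; ring).
  rewrite cos_period, neg_cos, IH; ring.
Qed.

(** Only odd frequencies occur, so a shift by [PI] flips every cosine at once. Together with
    evenness this reduces every quarter period to [[0, PI/2]]. *)
Lemma sqwave_fold (N k : nat) (s : R) :
  sqwave N (s + INR k * PI) = (1 - alt k) * leibniz N + alt k * sqwave N s.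
Proof.
unfold sqwave, leibniz.
rewrite <- !psum_scal, <- psum_plus; apply psum_ext; intros n.
rewrite odd_multiple_cos; ring.
Qed.

Lemma sqwave_opp (N : nat) (s : R) : sqwave N (- s) = sqwave N s.
Proof.
unfold sqwave; apply psum_ext; intros n.
rewrite Ropp_mult_distr_r_reverse, cos_neg; reflexivity.
Qed.

Lemma is_derive_monotone (f df : R -> R) (a b : R) :
  a <= b -> (forall x, a <= x <= b -> is_derive f x (df x)) ->
  (forall x, a <= x <= b -> 0 <= df x) -> f a <= f b.
Proof.
intros Hab Hd Hp.
destruct (MVT_gen f a b df) as [c [Hc Heq]].
- rewrite Rmin_left, Rmax_right by exact Hab; intros x Hx; apply Hd; lra.
- rewrite Rmin_left, Rmax_right by exact Hab; intros x Hx.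
  apply continuity_pt_filterlim, (ex_derive_continuous (V := R_NormedModule)).
  exists (df x); apply Hd; exact Hx.
- rewrite Rmin_left, Rmax_right in Hc by exact Hab.
  assert (0 <= df c * (b - a)) by (apply Rmult_le_pos; [apply Hp; exact Hc | lra]); lra.
Qed.

Lemma is_derive_le (f g df dg : R -> R) (a b : R) :
  a <= b -> (forall x, a <= x <= b -> is_derive f x (df x)) ->
  (forall x, a <= x <= b -> is_derive g x (dg x)) ->
  (forall x, a <= x <= b -> df x <= dg x) -> f b - f a <= g b - g a.
Proof.
intros Hab Hf Hg Hle.
assert (g a - f a <= g b - f b); [|lra].
apply (is_derive_monotone (fun x => g x - f x) (fun x => dg x - df x)); [exact Hab | |].
- intros x Hx; apply (is_derive_minus (V := R_NormedModule)); auto.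
- intros x Hx; specialize (Hle x Hx); lra.
Qed.

Lemma is_derive_abs_le (f g df dg : R -> R) (a b : R) :
  a <= b -> (forall x, a <= x <= b -> is_derive f x (df x)) ->
  (forall x, a <= x <= b -> is_derive g x (dg x)) ->
  (forall x, a <= x <= b -> Rabs (df x) <= dg x) -> Rabs (f b - f a) <= g b - g a.
Proof.
intros Hab Hf Hg Hle; apply Rabs_le; split.
- assert (H : - f b - - f a <= g b - g a).
  { apply (is_derive_le (fun x => - f x) g (fun x => - df x) dg); auto.
    - intros x Hx; apply (is_derive_opp (V := R_NormedModule)); auto.
    - intros x Hx; specialize (Hle x Hx); apply Rabs_le_between in Hle; lra. }
  lra.
- apply (is_derive_le f g df dg); auto.
  intros x Hx; specialize (Hle x Hx); apply Rabs_le_between in Hle; lra.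
Qed.

(* Integration by parts of the derivative of [sqwave N], which is
   [- alt N * sin (2 N t) / (2 cos t)]. *)
Lemma sqwave_decay (N : nat) (t : R) :
  (1 <= N)%nat -> 0 <= t < PI / 2 -> Rabs (sqwave N t) <= / (2 * INR N * cos t).
Proof.
intros HN Ht.
assert (HN0 : 0 < INR N) by (apply lt_0_INR; lia).
assert (Hc : forall x, 0 <= x <= t -> 0 < cos x) by (intros x Hx; apply cos_gt_0; lra).
(* Once the boundary term is subtracted, the remaining derivative is at most [sin x / (4 N cos^2 x)]
   in absolute value, and that is the derivative of [/ (4 N cos x)]. *)
assert (H : Rabs ((sqwave N t - alt N * cos (2 * INR N * t) / (4 * INR N * cos t))
   - (sqwave N 0 - alt N * cos (2 * INR N * 0) / (4 * INR N * cos 0)))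
   <= / (4 * INR N * cos t) - / (4 * INR N * cos 0)).
{ apply (is_derive_abs_le (fun t => sqwave N t -
  alt N * cos (2 * INR N * t) / (4 * INR N * cos t))
    (fun t => / (4 * INR N * cos t))
    (fun x => - alt N * cos (2 * INR N * x) * sin x / (4 * INR N * (cos x)^2))
    (fun x => sin x / (4 * INR N * (cos x)^2))).
  - lra.
  - intros x Hx; specialize (Hc x Hx).
    generalize (sqwave_derive N x) (alt_sin_kernel N x).
    set (P := psum (fun n => alt n * sin (odd n * x)) N); intros Hd HP.
    assert (HP' : P = - alt N * sin (2 * INR N * x) / (2 * cos x)).
    { rewrite <- HP; field; lra. }
    evar_last.
    { apply (is_derive_minus (V := R_NormedModule)); [exact Hd|].
      auto_derive; [|reflexivity].
      assert (0 < 4 * INR N * cos x) by (apply Rmult_lt_0_compat; lra); lra. }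
    unfold minus, plus, opp; simpl; rewrite HP'; field; lra.
  - intros x Hx; specialize (Hc x Hx); auto_derive; [|field; lra].
    assert (0 < 4 * INR N * cos x) by (apply Rmult_lt_0_compat; lra); lra.
  - intros x Hx; specialize (Hc x Hx).
    assert (Hs : 0 <= sin x) by (apply sin_ge_0; lra).
    assert (Hd : 0 < 4 * INR N * (cos x)^2).
    { apply Rmult_lt_0_compat; [lra | apply pow_lt; exact Hc]. }
    unfold Rdiv; rewrite !Rabs_mult, Rabs_Ropp, alt_abs, Rmult_1_l.
    rewrite (Rabs_pos_eq (sin x) Hs), (Rabs_pos_eq (/ _)) by (left; apply Rinv_0_lt_compat;
      exact Hd).
    apply Rmult_le_compat_r; [left; apply Rinv_0_lt_compat; exact Hd|].
    rewrite <- (Rmult_1_l (sin x)) at 2; apply Rmult_le_compat_r; [exact Hs|].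
    apply Rabs_le, COS_bound. }
rewrite sqwave_0, Rmult_0_r, cos_0 in H.
assert (Hct : 0 < cos t) by (apply Hc; lra).
set (c := / (4 * INR N * cos t)) in *.
assert (Hcp : 0 < c) by (unfold c; apply Rinv_0_lt_compat, Rmult_lt_0_compat; lra).
replace (/ (2 * INR N * cos t)) with (2 * c) by (unfold c; field; lra).
assert (Hq : Rabs (alt N * cos (2 * INR N * t) / (4 * INR N * cos t)) <= c).
{ unfold Rdiv; fold c; rewrite !Rabs_mult, alt_abs, (Rabs_pos_eq c) by lra.
  assert (Rabs (cos (2 * INR N * t)) <= 1) by apply Rabs_le, COS_bound.
  rewrite Rmult_1_l; nra. }
(* The boundary term at 0 has size exactly [/ (4 N)], which the value of the comparison function at
   0 cancels; [2 * c] is left. *)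
assert (Hq0 : Rabs (alt N * 1 / (4 * INR N * 1)) = / (4 * INR N * 1)).
{ unfold Rdiv; rewrite !Rabs_mult, alt_abs, Rabs_R1, Rabs_pos_eq; [ring|].
  left; apply Rinv_0_lt_compat; lra. }
revert H Hq Hq0.
generalize (alt N * cos (2 * INR N * t) / (4 * INR N * cos t)) (alt N * 1 / (4 * INR N * 1))
  (/ (4 * INR N * 1)).
intros x y z; unfold Rabs; repeat destruct Rcase_abs; lra.
Qed.

(** A weak form of Jordan's inequality. Up to [PI/3] the derivative [cos] is at least 1/2; beyond,
    [sin x >= sqrt 3 / 2] already exceeds [PI/4]. *)
Lemma sin_ge_half (x : R) : 0 <= x <= PI / 2 -> x / 2 <= sin x.
Proof.
intros Hx.
destruct (Rle_dec x (PI / 3)) as [H | H].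
- assert (Hd : x / 2 - 0 / 2 <= sin x - sin 0).
  { apply (is_derive_le (fun x => x / 2) sin (fun _ => / 2) cos); [lra | | |].
    + intros y _; auto_derive; [exact I | ring].
    + intros y _; apply is_derive_sin.
    + intros y Hy; replace (/ 2) with (cos (PI / 3)) by (rewrite cos_PI3; lra).
      apply cos_decr_1; lra. }
  rewrite sin_0 in Hd; lra.
- assert (Hs : sin (PI / 3) <= sin x) by (apply sin_incr_1; lra).
  rewrite sin_PI3 in Hs.
  assert (H3 : 1.7 <= sqrt 3).
  { rewrite <- (sqrt_pow2 1.7) by lra; apply sqrt_le_1; lra. }
  (* Five terms of Leibniz's series give [PI/4 < 0.85]. *)
  generalize (proj2 (PI_ineq 2)); unfold tg_alt, PI_tg; simpl; lra.
Qed.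

Lemma abs_sin_le (x : R) : Rabs (sin x) <= Rabs x.
Proof.
assert (Hp : forall y, 0 <= y -> Rabs (sin y) <= y).
{ intros y Hy.
  assert (Hd : Rabs (sin y - sin 0) <= y - 0).
  { apply (is_derive_abs_le sin (fun x => x) cos (fun _ => 1)); [exact Hy | | |].
    + intros z _; apply is_derive_sin.
    + intros z _; apply @is_derive_id.
    + intros z _; apply Rabs_le, COS_bound. }
  rewrite sin_0, !Rminus_0_r in Hd; exact Hd. }
destruct (Rle_dec 0 x) as [H | H].
- rewrite (Rabs_pos_eq x H); auto.
- rewrite <- (Rabs_Ropp x), <- (Rabs_Ropp (sin x)), <- sin_neg, (Rabs_pos_eq (- x)) by lra.
  apply Hp; lra.
Qed.

Lemma sum_f_R0_psum (f : nat -> R) (N : nat) : sum_f_R0 f N = psum f (S N).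
Proof. induction N as [|N IH]; simpl in *; [ring | rewrite IH; reflexivity]. Qed.

Lemma leibniz_tg_alt (N : nat) : sum_f_R0 (tg_alt PI_tg) N = leibniz (S N).
Proof.
rewrite sum_f_R0_psum; apply psum_ext; intros n.
unfold tg_alt, PI_tg, alt, odd; rewrite plus_INR, mult_INR; reflexivity.
Qed.

Lemma leibniz_lim : is_lim_seq leibniz (PI / 4).
Proof.
apply is_lim_seq_incr_1.
apply is_lim_seq_ext with (sum_f_R0 (tg_alt PI_tg)); [exact leibniz_tg_alt|].
rewrite <- Alt_PI_eq; unfold Alt_PI.
destruct exist_PI as [l Hl].
replace (4 * l / 4) with l by field.
apply is_lim_seq_Reals; exact Hl.
Qed.

Lemma leibniz_bounds (N : nat) : 0 <= leibniz N <= 1.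
Proof.
assert (Hd : forall n, leibniz (2 * S n) = leibniz (2 * n) + (/ odd (2 * n) -
  / odd (2 * n + 1))).
{ intros n; unfold leibniz; replace (2 * S n)%nat with (S (S (2 * n))) by lia; cbn [psum].
  unfold alt; rewrite <- tech_pow_Rmult, pow_1_even.
  replace (2 * n + 1)%nat with (S (2 * n)) by lia; unfold Rdiv; ring. }
assert (Hdec : forall n, / odd (S n) <= / odd n).
{ intros n; apply Rinv_le_contravar; [apply odd_pos|]; unfold odd; rewrite S_INR; lra. }
assert (He : forall n, 0 <= leibniz (2 * n) /\ leibniz (2 * n) + / odd (2 * n) <= 1).
{ induction n as [|n IH].
  - unfold leibniz, odd; simpl; split; [lra|]; right; field.
  - rewrite Hd; generalize (Hdec (2 * n)%nat) (Hdec (2 * n + 1)%nat).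
    replace (S (2 * n + 1)) with (2 * S n)%nat by lia.
    replace (2 * n + 1)%nat with (S (2 * n)) by lia; lra. }
destruct (Nat.Even_or_Odd N) as [[n ->] | [n ->]].
- destruct (He n); generalize (Rinv_0_lt_compat _ (odd_pos (2 * n))); lra.
- replace (2 * n + 1)%nat with (S (2 * n)) by lia; unfold leibniz; cbn [psum].
  fold (leibniz (2 * n)); unfold alt; rewrite pow_1_even.
  destruct (He n); generalize (Rinv_0_lt_compat _ (odd_pos (2 * n))); unfold Rdiv; lra.
Qed.

(** Linearity in [t], uniformly in [N], offsets the singularity of the cosecant at 0, and
    boundedness near [PI/2] controls the Gibbs overshoot. For [t > 1] the constant 2 is enough; it
    is proved according to whether the distance [s] to the jump is below or above [1/N]. *)
Lemma sqwave_bound (N : nat) (t : R) :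
  0 <= t <= PI / 2 -> Rabs (sqwave N t) <= 2 * t.
Proof.
intros Ht.
assert (H3 : 3 < PI) by (generalize PI2_3_2; lra).
destruct N as [|N'].
{ unfold sqwave; simpl; rewrite Rabs_R0; lra. }
set (N := S N').
assert (HN0 : 0 < INR N) by (apply lt_0_INR; unfold N; lia).
destruct (Rle_dec t 1) as [H1 | H1].
- assert (Hd : Rabs (sqwave N t - sqwave N 0) <= t - 0).
  { apply (is_derive_abs_le (sqwave N) (fun x => x)
      (fun t => psum (fun n => alt n * sin (odd n * t)) N) (fun _ => 1)); [lra | | |].
    + intros z _; apply sqwave_derive.
    + intros z _; apply @is_derive_id.
    + intros z Hz; generalize (alt_sin_kernel N z).
      set (P := psum _ _); intros HP.
      (* Since [1 <= PI/3], the factor [2 cos z] is at least 1, so the closed form bounds the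
         derivative by 1. *)
      assert (Hc : 1 / 2 <= cos z).
      { replace (1 / 2) with (cos (PI / 3)) by apply cos_PI3.
        apply cos_decr_1; lra. }
      assert (Ha : Rabs (2 * cos z * P) <= 1).
      { rewrite HP, Rabs_mult, Rabs_Ropp, alt_abs, Rmult_1_l.
        apply Rabs_le, SIN_bound. }
      rewrite Rabs_mult, (Rabs_pos_eq (2 * cos z)) in Ha by lra.
      generalize (Rabs_pos P); nra. }
  rewrite sqwave_0, !Rminus_0_r in Hd; lra.
- set (s := PI / 2 - t).
  assert (H2 : Rabs (sqwave N t) <= 2); [|lra].
  destruct (Rle_dec s (/ INR N)) as [Hs | Hs].
  (* Close to the jump, expansion about [PI/2] turns the cosines into [alt n * sin (odd n * s)].
     Each of the [N] terms is then at most [s], and [N s <= 1]. *)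
  + assert (E : sqwave N t = leibniz N - psum (fun n => sin (odd n * s) / odd n) N).
    { unfold sqwave, leibniz; rewrite <- psum_minus; apply psum_ext; intros n.
      replace t with (- s + INR 1 * (PI / 2)) by (unfold s; simpl; lra).
      assert (Hcs : cos (odd n * (- s + INR 1 * (PI / 2))) = alt n * sin (odd n * s)).
      { simpl INR; replace (odd n * (- s + 1 * (PI / 2))) with
          (PI / 2 - odd n * s + INR n * PI) by (unfold odd; field).
        rewrite cos_plus_INR_PI, cos_shift; reflexivity. }
      rewrite Hcs; generalize (alt_sq n) (odd_pos n); intros Ha Ho.
      replace (alt n / odd n * (1 - alt n * sin (odd n * s))) with
        (alt n / odd n - (alt n * alt n) * sin (odd n * s) / odd n) by (field; lra).
      rewrite Ha; field; lra. }
    rewrite E; generalize (leibniz_bounds N); intros HL.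
    assert (HS : Rabs (psum (fun n => sin (odd n * s) / odd n) N) <= INR N * s).
    { eapply Rle_trans; [apply (psum_abs_le _ (fun _ => s))|].
      - intros n; unfold Rdiv; rewrite Rabs_mult.
        rewrite (Rabs_pos_eq (/ _)) by (left; apply Rinv_0_lt_compat, odd_pos).
        apply (Rmult_le_reg_r (odd n)); [apply odd_pos|].
        rewrite Rmult_assoc, Rinv_l by (generalize (odd_pos n); lra).
        rewrite Rmult_1_r; eapply Rle_trans; [apply abs_sin_le|].
        rewrite Rabs_pos_eq; [lra|].
        apply Rmult_le_pos; [left; apply odd_pos | unfold s; lra].
      - right; clear; induction N as [|N IH]; [simpl; ring|].
        cbn [psum]; rewrite IH, S_INR; ring. }
    assert (INR N * s <= 1).
    { apply (Rmult_le_compat_l (INR N)) in Hs; [|lra]; rewrite Rinv_r in Hs; lra. }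
    revert HS; unfold Rabs; repeat destruct Rcase_abs; lra.
  (* Away from the jump, [cos t = sin s >= s/2] and [N s >= 1], so the decay estimate is bounded by
     a constant. *)
  + assert (Hs0 : 0 < / INR N) by (apply Rinv_0_lt_compat; exact HN0).
    eapply Rle_trans; [apply sqwave_decay; [unfold N; lia | unfold s in *; lra]|].
    replace (cos t) with (sin s) by (unfold s; rewrite sin_shift; reflexivity).
    assert (s / 2 <= sin s) by (apply sin_ge_half; unfold s in *; lra).
    assert (1 <= INR N * s).
    { rewrite <- (Rinv_r (INR N)) by lra; apply Rmult_le_compat_l; lra. }
    rewrite <- (Rinv_inv 2); apply Rinv_le_contravar; [lra|]; nra.
Qed.

(** * The square wave integrated against a cosecant *)

Lemma abs_RInt_le_open (f : R -> R) (a b M : R) :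
  a <= b -> ex_RInt f a b -> (forall t, a < t < b -> Rabs (f t) <= M) ->
  Rabs (RInt f a b) <= (b - a) * M.
Proof.
intros Hab Hf HM.
assert (Hc : forall c, RInt (fun _ : R => c) a b = (b - a) * c).
{ intros c; apply (RInt_const (V := R_CompleteNormedModule)). }
assert (Hec : forall c : R, ex_RInt (fun _ : R => c) a b).
{ intros c; apply (ex_RInt_const (V := R_NormedModule)). }
apply Rabs_le; split.
- replace (- ((b - a) * M)) with ((b - a) * - M) by ring; rewrite <- Hc.
  apply RInt_le; auto; intros t Ht; specialize (HM t Ht); apply Rabs_le_between in HM; lra.
- rewrite <- Hc.
  apply RInt_le; auto; intros t Ht; specialize (HM t Ht); apply Rabs_le_between in HM; lra.
Qed.

(** An elementary form of bounded convergence: the crude bound [B] is paid only on two end intervals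
    of length [delta]. *)
Lemma abs_RInt_le_middle (f : R -> R) (a b B eta delta : R) :
  0 < delta -> 2 * delta <= b - a -> ex_RInt f a b ->
  (forall t, a < t < b -> Rabs (f t) <= B) ->
  (forall t, a + delta < t < b - delta -> Rabs (f t) <= eta) ->
  Rabs (RInt f a b) <= 2 * delta * B + (b - a - 2 * delta) * eta.
Proof.
intros Hd Hab Hf HB He.
assert (Hf1 : ex_RInt f a (a + delta)).
{ apply (ex_RInt_Chasles_1 (V := R_CompleteNormedModule)) with (c := b); [lra | exact Hf]. }
assert (Hf23 : ex_RInt f (a + delta) b).
{ apply (ex_RInt_Chasles_2 (V := R_CompleteNormedModule)) with (a := a); [lra | exact Hf]. }
assert (Hf2 : ex_RInt f (a + delta) (b - delta)).
{ apply (ex_RInt_Chasles_1 (V := R_CompleteNormedModule)) with (c := b); [lra | exact Hf23]. }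
assert (Hf3 : ex_RInt f (b - delta) b).
{ apply (ex_RInt_Chasles_2 (V := R_CompleteNormedModule)) with (a := a + delta);
  [lra | exact Hf23]. }
assert (E1 := RInt_Chasles (V := R_CompleteNormedModule) f _ _ _ Hf1 Hf23).
assert (E2 := RInt_Chasles (V := R_CompleteNormedModule) f _ _ _ Hf2 Hf3).
unfold plus in E1, E2; simpl in E1, E2; rewrite <- E1, <- E2.
assert (I1 := abs_RInt_le_open f a (a + delta) B ltac:(lra) Hf1 ltac:(intros; apply HB; lra)).
assert (I2 := abs_RInt_le_open f (a + delta) (b - delta) eta ltac:(lra) Hf2 ltac:(intros;
  apply He; lra)).
assert (I3 := abs_RInt_le_open f (b - delta) b B ltac:(lra) Hf3 ltac:(intros; apply HB; lra)).
eapply Rle_trans; [apply Rabs_triang|].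
eapply Rle_trans; [apply Rplus_le_compat_l, Rabs_triang|].
lra.
Qed.

(** [sg t] is the distance to the end of the quarter period that lies mid-plateau, in either
    orientation, so that one statement covers all four quarters; the jump is at [sg t = PI/2]. [D N]
    stands for the integrand minus what survives in the limit. *)
Lemma quarter_wave_lim (D : nat -> R -> R) (sg : R -> R) (a M : R) :
  (forall t, sg t = t - a) \/ (forall t, sg t = a + PI / 2 - t) -> 0 <= M ->
  (forall N t, a < t < a + PI / 2 -> Rabs (D N t) * sg t <= M * Rabs (sqwave N (sg t))) ->
  (forall N, ex_RInt (D N) a (a + PI / 2)) ->
  is_lim_seq (fun N => RInt (D N) a (a + PI / 2)) 0.
Proof.
intros Hsg HM HD Hex.
assert (HPI : 0 < PI) by apply PI_RGT_0.
assert (Hsg1 : forall d t, a + d < t < a + PI / 2 - d -> d < sg t < PI / 2 - d).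
{ intros d t Ht; destruct Hsg as [Hsg | Hsg]; rewrite Hsg; lra. }
apply is_lim_seq_spec; intros eps.
destruct eps as [eps Heps]; simpl.
(* [d] makes the two end intervals cost at most [eps/2], and [C / N] will bound the middle. The
   increments in [M + 1] and [C + 1] keep the denominators positive. *)
set (d := Rmin (PI / 8) (eps / (8 * (M + 1)))).
assert (Hd1 : d <= PI / 8) by apply Rmin_l.
assert (Hd2 : 4 * M * d <= eps / 2).
{ assert (d <= eps / (8 * (M + 1))) by apply Rmin_r.
  apply Rle_trans with (4 * (M + 1) * (eps / (8 * (M + 1)))).
  - assert (0 < eps / (8 * (M + 1))) by (apply Rdiv_lt_0_compat; lra); nra.
  - right; field; lra. }
assert (Hd0 : 0 < d).
{ apply Rmin_glb_lt; [lra | apply Rdiv_lt_0_compat; lra]. }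
assert (Hsd : 0 < sin d) by (apply sin_gt_0; lra).
set (C := M * (PI / 2) / (2 * d * sin d)).
assert (Hds : 0 < 2 * d * sin d) by (apply Rmult_lt_0_compat; lra).
assert (HC : 0 <= C).
{ apply Rdiv_le_0_compat; [apply Rmult_le_pos; lra | exact Hds]. }
destruct (archimed_cor1 (eps / (2 * (C + 1)))) as [N0 [HN0 HN0p]].
{ apply Rdiv_lt_0_compat; lra. }
exists N0; intros N HN.
assert (HNp : 0 < INR N0) by (apply lt_0_INR; exact HN0p).
assert (HNN : INR N0 <= INR N) by (apply le_INR; exact HN).
assert (HNi : / INR N <= / INR N0) by (apply Rinv_le_contravar; lra).
assert (Hni0 : 0 < / INR N) by (apply Rinv_0_lt_compat; lra).
rewrite Rminus_0_r.
eapply Rle_lt_trans.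
- apply (abs_RInt_le_middle (D N) a (a + PI / 2) (2 * M) (M / (2 * d * sin d) * / INR N) d).
  + exact Hd0.
  + lra.
  + apply Hex.
  + intros t Ht; specialize (HD N t Ht).
    destruct (Hsg1 0 t) as [S1 S2]; [lra|].
    assert (Hw := sqwave_bound N (sg t) ltac:(lra)).
    apply (Rmult_le_reg_r (sg t)); [exact S1|].
    generalize (Rabs_pos (sqwave N (sg t))); nra.
  + intros t Ht; assert (HD' := HD N t ltac:(lra)).
    destruct (Hsg1 d t) as [S1 S2]; [lra|].
    assert (Hw := sqwave_decay N (sg t) ltac:(lia) ltac:(lra)).
    assert (Hcs : sin d <= cos (sg t)).
    { rewrite <- cos_shift; apply cos_decr_1; lra. }
    assert (Hw2 : Rabs (sqwave N (sg t)) <= / (2 * sin d) * / INR N).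
    { eapply Rle_trans; [exact Hw|]; rewrite <- Rinv_mult.
      apply Rinv_le_contravar; [apply Rmult_lt_0_compat; lra|].
      nra. }
    apply (Rmult_le_reg_r (sg t)); [lra|].
    eapply Rle_trans; [exact HD'|].
    eapply Rle_trans; [apply Rmult_le_compat_l; [exact HM | exact Hw2]|].
    apply Rle_trans with (M / (2 * d * sin d) * / INR N * d).
    * right; field; lra.
    * apply Rmult_le_compat_l; [|lra].
      apply Rmult_le_pos; [apply Rdiv_le_0_compat; lra | lra].
- assert (H1 : 2 * d * (2 * M) <= eps / 2) by lra.
  assert (H2 : (a + PI / 2 - a - 2 * d) * (M / (2 * d * sin d) * / INR N) <= C * / INR N).
  { replace (C * / INR N) with ((PI / 2) * (M / (2 * d * sin d) * / INR N)) by (unfold C;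
    field; lra).
    apply Rmult_le_compat_r; [|lra].
    apply Rmult_le_pos; [apply Rdiv_le_0_compat; lra | lra]. }
  assert (H3 : C * / INR N < eps / 2); [|lra].
  apply Rle_lt_trans with ((C + 1) * / INR N); [nra|].
  apply (Rmult_lt_reg_l (/ (C + 1))); [apply Rinv_0_lt_compat; lra|].
  rewrite <- Rmult_assoc, Rinv_l, Rmult_1_l by lra.
  replace (/ (C + 1) * (eps / 2)) with (eps / (2 * (C + 1))) by (field; lra).
  lra.
Qed.

(** The weight [1 / (2 sin v)] after the substitution [t = 4 K v], which maps [[0, PI/2]] to [K]
    full periods [[0, 2 K PI]]. *)
Definition kernel (K : nat) (t : R) : R := / (2 * sin (t / (4 * INR K))).

(* [sqwave N t * kernel K t], written so that it is smooth at [t = 0]. *)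
Definition wave_kernel (K N : nat) (t : R) : R :=
  psum (fun n => alt n / odd n *
    psum (fun j => sin (odd j * (t / (4 * INR K)))) (2 * K * (2 * n + 1))) N.

Lemma wave_kernel_spec (K : nat) (HK : 0 < INR K) (N : nat) (t : R) :
  2 * sin (t / (4 * INR K)) * wave_kernel K N t = sqwave N t.
Proof.
unfold wave_kernel, sqwave; rewrite <- psum_scal; apply psum_ext; intros n.
transitivity (alt n / odd n * (2 * sin (t / (4 * INR K)) *
  psum (fun j => sin (odd j * (t / (4 * INR K)))) (2 * K * (2 * n + 1)))); [ring|].
rewrite sin_kernel; do 3 f_equal.
rewrite !mult_INR, plus_INR, mult_INR; unfold odd; simpl; field; lra.
Qed.

Lemma kernel_small (K : nat) (HK : 0 < INR K) (t : R) :
  0 < t <= 2 * INR K * PI -> 0 < sin (t / (4 * INR K)) /\ 0 < kernel K t /\ kernel K t * t <=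
    4 * INR K.
Proof.
intros Ht.
assert (H0 : 0 < t / (4 * INR K)) by (apply Rdiv_lt_0_compat; lra).
assert (H1 : t / (4 * INR K) <= PI / 2).
{ apply (Rmult_le_reg_r (4 * INR K)); [lra|].
  unfold Rdiv at 1; rewrite Rmult_assoc, Rinv_l by lra; lra. }
assert (H2 := sin_ge_half (t / (4 * INR K)) ltac:(lra)).
assert (H3 : 0 < sin (t / (4 * INR K))) by lra.
split; [exact H3|]; unfold kernel; split; [apply Rinv_0_lt_compat; lra|].
apply (Rmult_le_reg_l (2 * sin (t / (4 * INR K)))); [lra|].
rewrite <- Rmult_assoc, Rinv_r, Rmult_1_l by lra.
replace t with (t / (4 * INR K) / 2 * (8 * INR K)) at 1 by (field; lra).
nra.
Qed.

Lemma wave_kernel_factor (K : nat) (HK : 0 < INR K) (N : nat) (t : R) :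
  0 < t <= 2 * INR K * PI -> wave_kernel K N t = sqwave N t * kernel K t.
Proof.
intros Ht; destruct (kernel_small K HK t Ht) as [Hs _].
rewrite <- (wave_kernel_spec K HK); unfold kernel; field; lra.
Qed.

Lemma wave_kernel_continuous (K N : nat) (t : R) : continuous (wave_kernel K N) t.
Proof.
unfold wave_kernel.
apply (continuous_psum (fun n t => alt n / odd n *
    psum (fun j => sin (odd j * (t / (4 * INR K)))) (2 * K * (2 * n + 1)))); intros n.
apply (continuous_scal_r (V := R_NormedModule)).
apply (continuous_psum (fun j t => sin (odd j * (t / (4 * INR K))))); intros j.
apply (ex_derive_continuous (V := R_NormedModule)); auto_derive; exact I.
Qed.

Lemma ex_RInt_wave_kernel (K N : nat) (a b : R) : ex_RInt (wave_kernel K N) a b.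
Proof.
apply (ex_RInt_continuous (V := R_CompleteNormedModule)); intros; apply wave_kernel_continuous.
Qed.

(** At the upper limit [t / (4 K) = PI/2], where the cosine of every odd multiple vanishes; each
    sine therefore integrates to [4 K / odd j]. *)
Lemma RInt_wave_kernel (K : nat) (HK : 0 < INR K) (N : nat) :
  RInt (wave_kernel K N) 0 (2 * INR K * PI) =
  4 * INR K * psum (fun n => alt n / odd n * oddharm (2 * K * (2 * n + 1))) N.
Proof.
apply is_RInt_unique; rewrite <- psum_scal; unfold wave_kernel.
evar_last; [|apply psum_ext; intros n].
- apply (is_RInt_psum (fun n t => alt n / odd n *
    psum (fun j => sin (odd j * (t / (4 * INR K)))) (2 * K * (2 * n + 1)))
   (fun n => alt n / odd n * psum (fun j => 4 * INR K / odd j) (2 * K * (2 * n + 1))));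
     intros n.
  apply (is_RInt_scal (V := R_NormedModule)).
  apply (is_RInt_psum (fun j t => sin (odd j * (t / (4 * INR K))))
    (fun j => 4 * INR K / odd j)).
  intros j; evar_last.
  + apply (is_RInt_derive (V := R_CompleteNormedModule)
      (fun t => - (4 * INR K / odd j) * cos (odd j * (t / (4 * INR K))))).
    * intros t _; auto_derive; [exact I|]; change (t * / (4 * INR K)) with (t / (4 * INR K)).
      generalize (odd_pos j) (sin (odd j * (t / (4 * INR K)))); intros; field; lra.
    * intros t _; apply (ex_derive_continuous (V := R_NormedModule)); auto_derive; exact I.
  + unfold minus, plus, opp; simpl.
    replace (odd j * (0 / (4 * INR K))) with 0 by (field; lra).
    replace (odd j * (2 * INR K * PI / (4 * INR K))) with (PI / 2 + INR j * PI)
      by (unfold odd; field; lra).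
    rewrite cos_plus_INR_PI, cos_PI2, cos_0; ring.
- unfold oddharm.
  rewrite (psum_ext _ (fun j => 4 * INR K * / odd j)), psum_scal by (intros; reflexivity);
    ring.
Qed.

Lemma is_RInt_kernel (K : nat) (HK : 0 < INR K) (a b : R) :
  0 < a <= b -> b <= 2 * INR K * PI ->
  is_RInt (kernel K) a b
    (2 * INR K * ln (tan (b / (8 * INR K))) - 2 * INR K * ln (tan (a / (8 * INR K)))).
Proof.
intros Ha Hb.
(* The antiderivative [ln (tan (v/2)) / 2] of [1 / (2 sin v)], rescaled by [v = t / (4 K)]. *)
apply (is_RInt_derive (V := R_CompleteNormedModule)
  (fun t => 2 * INR K * ln (tan (t / (8 * INR K))))).
- rewrite Rmin_left, Rmax_right by lra; intros t Ht.
  assert (H0 : 0 < t / (8 * INR K)) by (apply Rdiv_lt_0_compat; lra).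
  assert (H1 : t / (8 * INR K) <= PI / 4).
  { apply (Rmult_le_reg_r (8 * INR K)); [lra|].
    unfold Rdiv at 1; rewrite Rmult_assoc, Rinv_l by lra; lra. }
  assert (HPI := PI_RGT_0).
  assert (Hs : 0 < sin (t / (8 * INR K))) by (apply sin_gt_0; lra).
  assert (Hc : 0 < cos (t / (8 * INR K))) by (apply cos_gt_0; lra).
  assert (Ht0 : 0 < tan (t / (8 * INR K))) by (apply Rdiv_lt_0_compat; assumption).
  unfold kernel; replace (t / (4 * INR K)) with (2 * (t / (8 * INR K))) by (field; lra).
  rewrite sin_2a.
  unfold tan in *.
  auto_derive.
  + change (t * / (8 * INR K)) with (t / (8 * INR K)); split; [lra|]; split;
    [exact Ht0 | exact I].
  + change (t * / (8 * INR K)) with (t / (8 * INR K)).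
    assert (E := sin2_cos2 (t / (8 * INR K))); unfold Rsqr in E.
    revert Hs Hc E; generalize (sin (t / (8 * INR K))) (cos (t / (8 * INR K)));
      intros s c Hs Hc E.
    transitivity ((s * s + c * c) / (4 * s * c)); [field; lra | rewrite E; field; lra].
- rewrite Rmin_left, Rmax_right by lra; intros t Ht.
  destruct (kernel_small K HK t) as [Hs _]; [lra|].
  apply (ex_derive_continuous (V := R_NormedModule)); unfold kernel; auto_derive.
  change (t * / (4 * INR K)) with (t / (4 * INR K)); lra.
Qed.

Lemma ex_RInt_kernel (K : nat) (HK : 0 < INR K)
  (a b : R) : 0 < a <= b -> b <= 2 * INR K * PI -> ex_RInt (kernel K) a b.
Proof. intros Ha Hb; eexists; apply is_RInt_kernel; assumption. Qed.

(** [2 K] times this is the integral of [kernel K] over the half period, within period [k], on which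
    the limiting wave equals [PI/2]. *)
Definition wave_block (K k : nat) : R :=
  ln (tan ((4 * INR k + 3) * PI / (16 * INR K))) -
    ln (tan ((4 * INR k + 1) * PI / (16 * INR K))).

Lemma alt_even (k : nat) : alt (2 * k) = 1.
Proof. apply pow_1_even. Qed.

Lemma sqwave_period (N k : nat) (s : R) : sqwave N (s + 2 * INR k * PI) = sqwave N s.
Proof.
replace (s + 2 * INR k * PI) with (s + INR (2 * k) * PI) by (rewrite mult_INR; simpl; ring).
rewrite sqwave_fold, alt_even; ring.
Qed.

Lemma sqwave_half_period (N k : nat) (s : R) :
  sqwave N (s + 2 * INR k * PI + PI) = 2 * leibniz N - sqwave N s.
Proof.
replace (s + 2 * INR k * PI + PI) with (s + INR (2 * k + 1) * PI).
- rewrite sqwave_fold; unfold alt; rewrite pow_add, pow_1_even; ring.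
- rewrite plus_INR, mult_INR; simpl; ring.
Qed.

(** The period is cut into quarters: the wave tends to 0 on the outer two and to [PI/2] on the inner
    two. On the inner ones [2 * leibniz N], not its limit, is subtracted, because the difference is
    then exactly minus [sqwave N] at the folded argument. *)
Lemma wave_kernel_block (K : nat) (HK : 0 < INR K) (k : nat) :
  (k < K)%nat ->
  is_lim_seq (fun N => RInt (wave_kernel K N) (2 * INR k * PI) (2 * INR (S k) * PI))
    (INR K * PI * wave_block K k).
Proof.
intros Hk.
assert (HPI := PI_RGT_0).
assert (Hk0 := pos_INR k).
assert (HkK : INR k + 1 <= INR K) by (rewrite <- S_INR; apply le_INR; lia).
set (a := 2 * INR k * PI).
assert (Ha : 0 <= a) by (unfold a; nra).
assert (Hb : a + 2 * PI <= 2 * INR K * PI) by (unfold a; nra).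
(* The folded distance [s] never exceeds [t], so the single constant [4 * INR K] serves all quarters
   of all periods. *)
assert (Hker : forall t s, a < t < a + 2 * PI -> 0 <= s <= t ->
  forall x, Rabs (x * kernel K t) * s <= 4 * INR K * Rabs x).
{ intros t s Ht Hs x; destruct (kernel_small K HK t) as [_ [H1 H2]]; [lra|].
  rewrite Rabs_mult, (Rabs_pos_eq (kernel K t)) by lra.
  assert (kernel K t * s <= 4 * INR K) by nra.
  generalize (Rabs_pos x); nra. }
assert (Q1 := quarter_wave_lim (wave_kernel K) (fun t => t - a) a (4 * INR K)
  (or_introl (fun t => eq_refl)) ltac:(lra)).
assert (Q4 := quarter_wave_lim (wave_kernel K) (fun t => a + 3 * (PI / 2) + PI / 2 - t)
  (a + 3 * (PI / 2)) (4 * INR K) (or_intror (fun t => eq_refl)) ltac:(lra)).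
assert (Q2 := quarter_wave_lim (fun N t => wave_kernel K N t - 2 * leibniz N * kernel K t)
  (fun t => a + PI / 2 + PI / 2 - t)
  (a + PI / 2) (4 * INR K) (or_intror (fun t => eq_refl)) ltac:(lra)).
assert (Q3 := quarter_wave_lim (fun N t => wave_kernel K N t - 2 * leibniz N * kernel K t)
  (fun t => t - (a + PI))
  (a + PI) (4 * INR K) (or_introl (fun t => eq_refl)) ltac:(lra)).
assert (EW := fun N x y => ex_RInt_wave_kernel K N x y).
assert (EK : forall c x y, 0 < x <= y -> y <= 2 * INR K * PI -> ex_RInt (fun t => c * kernel K
  t) x y).
{ intros c x y H1 H2; apply (ex_RInt_scal (V := R_NormedModule)), ex_RInt_kernel; assumption. }
assert (ED : forall N x y, 0 < x <= y -> y <= 2 * INR K * PI ->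
  ex_RInt (fun t => wave_kernel K N t - 2 * leibniz N * kernel K t) x y).
{ intros N x y H1 H2; apply (ex_RInt_minus (V := R_NormedModule)); [apply EW | apply EK;
  assumption]. }
assert (RD : forall N x y, 0 < x <= y -> y <= 2 * INR K * PI ->
  RInt (wave_kernel K N) x y = RInt (fun t => wave_kernel K N t -
    2 * leibniz N * kernel K t) x y +
    2 * leibniz N * RInt (kernel K) x y).
{ intros N x y H1 H2.
  assert (I1 := RInt_correct (V := R_CompleteNormedModule) _ _ _ (EW N x y)).
  assert (I2 := is_RInt_scal (V := R_NormedModule) _ _ _ (2 * leibniz N) _
    (RInt_correct (V := R_CompleteNormedModule) _ _ _ (ex_RInt_kernel K HK x y H1 H2))).
  assert (I3 := is_RInt_minus (V := R_NormedModule) _ _ _ _ _ _ I1 I2).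
  apply (is_RInt_unique (V := R_CompleteNormedModule)) in I3.
  change (RInt (fun t => wave_kernel K N t - 2 * leibniz N * kernel K t) x y =
    RInt (wave_kernel K N) x y - 2 * leibniz N * RInt (kernel K) x y) in I3.
  assert (Eq : forall p q r : R, q = p - r -> p = q + r) by (intros; lra).
  apply Eq; exact I3. }
assert (L1 : is_lim_seq (fun N => RInt (wave_kernel K N) a (a + PI / 2)) 0).
{ apply Q1; [|intros; apply EW]; intros N t Ht.
  rewrite wave_kernel_factor by lra.
  replace (sqwave N t) with (sqwave N (t - a)).
  - apply Hker; lra.
  - rewrite <- (sqwave_period N k); f_equal; unfold a; ring. }
assert (L4 : is_lim_seq (fun N => RInt (wave_kernel K N) (a + 3 * (PI / 2)) (a + 2 * PI)) 0).
{ replace (a + 2 * PI) with (a + 3 * (PI / 2) + PI / 2) by field.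
  apply Q4; [|intros; apply EW]; intros N t Ht.
  rewrite wave_kernel_factor by lra.
  replace (sqwave N t) with (sqwave N (a + 3 * (PI / 2) + PI / 2 - t)).
  - apply Hker; lra.
  - rewrite <- (sqwave_period N (S k)), <- sqwave_opp.
    rewrite <- (sqwave_period N (S k)), <- (sqwave_period N (S k)).
    f_equal; rewrite S_INR; unfold a; field. }
assert (L2 : is_lim_seq (fun N => RInt (fun t => wave_kernel K N t -
  2 * leibniz N * kernel K t)
   (a + PI / 2) (a + PI)) 0).
{ replace (a + PI) with (a + PI / 2 + PI / 2) by field.
  apply Q2; [|intros; apply ED; lra]; intros N t Ht.
  rewrite wave_kernel_factor by lra.
  replace (sqwave N t * kernel K t - 2 * leibniz N * kernel K t) with
    (- sqwave N (a + PI / 2 + PI / 2 - t) * kernel K t).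
  - rewrite <- (Rabs_Ropp (sqwave N (a + PI / 2 + PI / 2 - t))); apply Hker; lra.
  - replace (sqwave N t) with (2 * leibniz N - sqwave N (t - a - PI)).
    + rewrite <- (sqwave_opp N (t - a - PI)).
      replace (- (t - a - PI)) with (a + PI / 2 + PI / 2 - t) by field; ring.
    + rewrite <- (sqwave_half_period N k); f_equal; unfold a; ring. }
assert (L3 : is_lim_seq (fun N => RInt (fun t => wave_kernel K N t -
  2 * leibniz N * kernel K t)
   (a + PI) (a + 3 * (PI / 2))) 0).
{ replace (a + 3 * (PI / 2)) with (a + PI + PI / 2) by field.
  apply Q3; [|intros; apply ED; lra]; intros N t Ht.
  rewrite wave_kernel_factor by lra.
  replace (sqwave N t * kernel K t - 2 * leibniz N * kernel K t) with
    (- sqwave N (t - (a + PI)) * kernel K t).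
  - rewrite <- (Rabs_Ropp (sqwave N (t - (a + PI)))); apply Hker; lra.
  - replace (sqwave N t) with (2 * leibniz N - sqwave N (t - (a + PI))); [ring|].
    rewrite <- (sqwave_half_period N k); f_equal; unfold a; ring. }
replace (2 * INR (S k) * PI) with (a + 2 * PI) by (rewrite S_INR; unfold a; ring).
assert (IK : RInt (kernel K) (a + PI / 2) (a + PI) + RInt (kernel K) (a + PI)
  (a + 3 * (PI / 2)) =
  2 * INR K * wave_block K k).
{ transitivity (RInt (kernel K) (a + PI / 2) (a + 3 * (PI / 2))).
  - apply (RInt_Chasles (V := R_CompleteNormedModule)); apply ex_RInt_kernel; lra.
  - rewrite (is_RInt_unique _ _ _ _ (is_RInt_kernel K HK (a + PI / 2)
    (a + 3 * (PI / 2)) ltac:(lra) ltac:(lra))).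
    unfold wave_block.
    replace ((a + 3 * (PI / 2)) / (8 * INR K)) with ((4 * INR k + 3) * PI / (16 * INR K))
      by (unfold a; field; lra).
    replace ((a + PI / 2) / (8 * INR K)) with ((4 * INR k + 1) * PI / (16 * INR K))
      by (unfold a; field; lra).
    ring. }
apply is_lim_seq_ext with (fun N =>
  RInt (wave_kernel K N) a (a + PI / 2) +
  RInt (fun t => wave_kernel K N t - 2 * leibniz N * kernel K t) (a + PI / 2) (a + PI) +
  RInt (fun t => wave_kernel K N t - 2 * leibniz N * kernel K t) (a + PI) (a + 3 * (PI / 2)) +
  RInt (wave_kernel K N) (a + 3 * (PI / 2)) (a + 2 * PI) +
  leibniz N * (2 * (2 * INR K * wave_block K k))).
- intros N; rewrite <- IK.
  rewrite <- (RInt_Chasles (V := R_CompleteNormedModule) (wave_kernel K N) a (a + PI / 2)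
    (a + 2 * PI)) by apply EW.
  rewrite <- (RInt_Chasles (V := R_CompleteNormedModule) (wave_kernel K N) (a + PI / 2)
    (a + PI) (a + 2 * PI)) by apply EW.
  rewrite <- (RInt_Chasles (V := R_CompleteNormedModule) (wave_kernel K N) (a + PI)
    (a + 3 * (PI / 2)) (a + 2 * PI)) by apply EW.
  unfold plus; simpl.
  rewrite (RD N (a + PI / 2) (a + PI)), (RD N (a + PI) (a + 3 * (PI / 2))) by lra; ring.
- replace (INR K * PI * wave_block K k) with
    (0 + 0 + 0 + 0 + PI / 4 * (2 * (2 * INR K * wave_block K k))) by field.
  repeat apply is_lim_seq_plus'; try assumption.
  apply is_lim_seq_mult'; [exact leibniz_lim | apply is_lim_seq_const].
Qed.

Lemma wave_identity (K : nat) (HK : 0 < INR K) :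
  is_lim_seq (fun N => psum (fun n => alt n / odd n * oddharm (2 * K * (2 * n + 1))) N)
    (PI / 4 * psum (wave_block K) K).
Proof.
assert (H : forall k, (k <= K)%nat ->
  is_lim_seq (fun N => RInt (wave_kernel K N) 0 (2 * INR k * PI))
    (INR K * PI * psum (wave_block K) k)).
{ induction k as [|k IH]; intros Hk.
  - simpl; apply is_lim_seq_ext with (fun _ => 0).
    + intros N; replace (2 * 0 * PI) with 0 by ring.
      symmetry; apply (RInt_point (V := R_CompleteNormedModule)).
    + rewrite Rmult_0_r; apply is_lim_seq_const.
  - cbn [psum]; rewrite Rmult_plus_distr_l.
    apply is_lim_seq_ext with (fun N => RInt (wave_kernel K N) 0 (2 * INR k * PI) +
      RInt (wave_kernel K N) (2 * INR k * PI) (2 * INR (S k) * PI)).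
    + intros N; apply (RInt_Chasles (V := R_CompleteNormedModule)); apply ex_RInt_wave_kernel.
    + apply is_lim_seq_plus'; [apply IH; lia | apply wave_kernel_block; [exact HK | lia]]. }
apply is_lim_seq_ext with (fun N => / (4 * INR K) * RInt (wave_kernel K N) 0 (2 * INR K * PI)).
- intros N; rewrite (RInt_wave_kernel K HK); field; lra.
- replace (PI / 4 * psum (wave_block K) K) with
    (/ (4 * INR K) * (INR K * PI * psum (wave_block K) K)) by (field; lra).
  apply is_lim_seq_mult'; [apply is_lim_seq_const | apply H; lia].
Qed.

(** * Harmonic sums and the limit of many periods *)

Definition harm (n : nat) : R := psum (fun k => / INR (S k)) n.

Lemma ln_le_sub_1 (x : R) : 0 < x -> ln x <= x - 1.
Proof. intros Hx; generalize (exp_ineq1_le (ln x)); rewrite exp_ln by exact Hx; lra. Qed.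

Lemma ln_succ_bounds (x : R) : 0 < x -> / (x + 1) <= ln (x + 1) - ln x <= / x.
Proof.
intros Hx; split.
- assert (H := ln_le_sub_1 (x / (x + 1)) ltac:(apply Rdiv_lt_0_compat; lra)).
  rewrite ln_div in H by lra.
  replace (x / (x + 1) - 1) with (- / (x + 1)) in H by (field; lra); lra.
- assert (H := ln_le_sub_1 ((x + 1) / x) ltac:(apply Rdiv_lt_0_compat; lra)).
  rewrite ln_div in H by lra.
  replace ((x + 1) / x - 1) with (/ x) in H by (field; lra); lra.
Qed.

Lemma harm_lim_ex : exists g : R,
  is_lim_seq (fun n => harm n - ln (INR n)) g /\
  forall n, (1 <= n)%nat -> Rabs (harm n - ln (INR n) - g) <= / INR n.
Proof.
(* [v] increases, [u] below decreases, and their gap is at most [1/(n+1)]: this gives the limit and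
   the rate together. The shifted indices keep [ln] away from 0. *)
set (v := fun n => harm (S n) - ln (INR (S (S n)))).
assert (Hpos : forall n, 0 < INR (S n)) by (intros; apply lt_0_INR; lia).
assert (Hln : forall n, / INR (S (S n)) <= ln (INR (S (S n))) - ln (INR (S n)) <= / INR (S n)).
{ intros n; generalize (ln_succ_bounds (INR (S n)) (Hpos n)); rewrite <- S_INR; auto. }
assert (Hv : forall n, v n <= v (S n)).
{ intros n; unfold v, harm; cbn [psum]; generalize (Hln (S n)); lra. }
set (u := fun n => harm (S n) - ln (INR (S n))).
assert (Hu : forall n, u (S n) <= u n).
{ intros n; unfold u, harm; cbn [psum]; generalize (Hln n); lra. }
assert (Huv : forall n, v n <= u n <= v n + / INR (S n)).
{ intros n; unfold u, v; generalize (Hln n) (Rinv_0_lt_compat _ (Hpos (S n))); lra. }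
assert (Hu0 : forall n, u n <= u 0%nat).
{ induction n as [|n IH]; [lra|]; specialize (Hu n); lra. }
destruct (ex_finite_lim_seq_incr v (u 0%nat)) as [g Hg]; [exact Hv| |].
{ intros n; specialize (Huv n); specialize (Hu0 n); lra. }
assert (Hvg : forall n, v n <= g) by (intros n; apply is_lim_seq_incr_compare; assumption).
assert (Hi : is_lim_seq (fun n => / INR (S n)) 0).
{ apply (is_lim_seq_incr_1 (fun n => / INR n)).
  replace (Finite 0) with (Rbar_inv p_infty) by reflexivity.
  apply is_lim_seq_inv; [apply is_lim_seq_INR | discriminate]. }
assert (Hgu : is_lim_seq u g).
{ apply is_lim_seq_le_le with (u := v) (w := fun n => v n + / INR (S n)).
  - exact Huv.
  - exact Hg.
  - replace g with (g + 0) by ring; apply is_lim_seq_plus'; assumption. }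
exists g; split.
- apply is_lim_seq_incr_1; exact Hgu.
- intros n Hn; destruct n as [|n]; [lia|].
  assert (Hug : g <= u n).
  { apply is_lim_seq_decr_compare; assumption. }
  specialize (Huv n); specialize (Hvg n); fold (u n).
  apply Rabs_le; lra.
Qed.

Lemma sum_n_m_harm (n : nat) : sum_n_m (fun k => / INR k) 1 n = harm n.
Proof.
induction n as [|n IH].
- rewrite sum_n_m_zero by lia; reflexivity.
- rewrite sum_n_Sm by lia; rewrite IH; reflexivity.
Qed.

Lemma euler_gamma_spec :
  is_lim_seq (fun n => harm n - ln (INR n)) euler_gamma /\
  forall n, (1 <= n)%nat -> Rabs (harm n - ln (INR n) - euler_gamma) <= / INR n.
Proof.
destruct harm_lim_ex as [g [Hg1 Hg2]].
assert (E : euler_gamma = g).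
{ unfold euler_gamma.
  rewrite (Lim_seq_ext _ (fun n => harm n - ln (INR n))) by (intros; rewrite sum_n_m_harm;
    reflexivity).
  rewrite (is_lim_seq_unique _ _ Hg1); reflexivity. }
rewrite E; split; assumption.
Qed.

Lemma oddharm_harm (n : nat) : oddharm n = harm (2 * n) - harm n / 2.
Proof.
unfold oddharm, harm; rewrite psum_double.
induction n as [|n IH]; cbn [psum]; [field|].
rewrite IH; unfold odd; rewrite !S_INR, plus_INR, mult_INR; simpl.
generalize (pos_INR n); intros; field; lra.
Qed.

(** The error [1/(2n)] of [harm (2 * n)] and half the error [1/n] of [harm n] add up to [1/n]. *)
Lemma oddharm_asympt (n : nat) : (1 <= n)%nat ->
  Rabs (oddharm n - (ln (INR n) / 2 + ln 2 + euler_gamma / 2)) <= / INR n.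
Proof.
intros Hn.
assert (H0 : 0 < INR n) by (apply lt_0_INR; lia).
assert (H1 := proj2 euler_gamma_spec n Hn).
assert (H2 := proj2 euler_gamma_spec (2 * n)%nat ltac:(lia)).
rewrite oddharm_harm.
rewrite mult_INR in H2; simpl INR in H2; replace (1 + 1) with 2 in H2 by ring.
rewrite ln_mult in H2 by lra.
rewrite Rinv_mult in H2.
revert H1 H2; unfold Rabs; repeat destruct Rcase_abs; lra.
Qed.

Lemma sum_inv_odd_sqr (N : nat) : psum (fun n => / (odd n * odd n)) N <= 2.
Proof.
(* Telescoping comparison: [1/(2n+3)^2 <= 1/((n+2)(n+3)) = 1/(n+2) - 1/(n+3)]. *)
assert (H : forall n, psum (fun n => / (odd n * odd n)) (S n) <= 2 - / (INR n + 2)).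
{ induction n as [|n IH].
  - unfold odd; simpl; lra.
  - cbn [psum] in *; rewrite S_INR.
    assert (Hn := pos_INR n).
    assert (/ (odd (S n) * odd (S n)) <= / (INR n + 2) - / (INR n + 1 + 2)); [|lra].
    replace (/ (INR n + 2) - / (INR n + 1 + 2)) with (/ ((INR n + 2) * (INR n + 3)))
      by (field; lra).
    unfold odd; rewrite S_INR; apply Rinv_le_contravar; nra. }
destruct N as [|N]; [simpl; lra|].
specialize (H N).
assert (0 < / (INR N + 2)); [|lra].
apply Rinv_0_lt_compat; generalize (pos_INR N); lra.
Qed.

(** Since [ln (2 K odd n) = ln (2 K) + ln (odd n)], the main terms split into a multiple of
    Leibniz's sum and the wanted logarithmic sum. The errors are at most [1 / (2 K (odd n)^2)],
    hence summable uniformly in [N]. *)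
Lemma wave_sum_error (K N : nat) : (1 <= K)%nat ->
  Rabs (psum (fun n => alt n / odd n * oddharm (2 * K * (2 * n + 1))) N -
    ((ln (2 * INR K) / 2 + ln 2 + euler_gamma / 2) * leibniz N +
     / 2 * psum (fun n => alt n / odd n * ln (odd n)) N)) <= / INR K.
Proof.
intros HK.
assert (HK0 : 0 < INR K) by (apply lt_0_INR; lia).
unfold leibniz; rewrite <- !psum_scal, <- psum_plus, <- psum_minus.
eapply Rle_trans; [apply (psum_abs_le _ (fun n => / (2 * INR K) * / (odd n * odd n)))|].
- intros n; assert (Ho := odd_pos n).
  set (m := (2 * K * (2 * n + 1))%nat).
  assert (Em : INR m = 2 * INR K * odd n).
  { unfold m, odd; rewrite !mult_INR, plus_INR, mult_INR; simpl; ring. }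
  assert (Hm := oddharm_asympt m ltac:(unfold m; lia)).
  rewrite Em, ln_mult in Hm by lra.
  match goal with |- Rabs ?x <= _ => replace x with
    (alt n / odd n * (oddharm m - ((ln (2 * INR K) + ln (odd n)) / 2 + ln 2 + euler_gamma /
      2))) end.
  2: field; lra.
  unfold Rdiv at 1; rewrite !Rabs_mult, alt_abs, Rmult_1_l.
  rewrite (Rabs_pos_eq (/ odd n)) by (left; apply Rinv_0_lt_compat; exact Ho).
  replace (/ (2 * INR K) * / (odd n * odd n)) with (/ odd n * / (2 * INR K * odd n))
    by (field; lra).
  apply Rmult_le_compat_l; [left; apply Rinv_0_lt_compat; exact Ho | exact Hm].
- rewrite psum_scal.
  apply Rle_trans with (/ (2 * INR K) * 2).
  + apply Rmult_le_compat_l; [left; apply Rinv_0_lt_compat; lra | apply sum_inv_odd_sqr].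
  + right; field; lra.
Qed.

(** * Convexity of [ln (tan x / x)] and sums of logarithms of tangents *)

(** At [y = 2 x] this is the nonnegativity of the second derivative of [ln (tan x) - ln x]. Up to
    [PI/2] Taylor polynomials suffice, with margin [y^4 (1/6 - y^2/72)]; beyond it the cosine is
    nonpositive. *)
Lemma sqr_cos_le (y : R) : 0 <= y < PI -> y ^ 2 * cos y <= sin y ^ 2.
Proof.
intros Hy.
destruct (Rle_dec y (PI / 2)) as [H | H].
- assert (Hs := proj1 (sin_bound y 0 ltac:(lra) ltac:(lra))).
  assert (Hc := proj2 (cos_bound y 0 ltac:(lra) ltac:(lra))).
  unfold sin_approx, sin_term, cos_approx, cos_term in *; simpl in Hs, Hc.
  assert (H2 : y <= 2) by (generalize PI_4; lra).
  assert (Hs' : y - y ^ 3 / 6 <= sin y) by (simpl; lra).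
  assert (Hc' : cos y <= 1 - y ^ 2 / 2 + y ^ 4 / 24) by (simpl; lra).
  clear Hs Hc.
  assert (Hy2 : 0 <= y ^ 2 <= 4) by (split; nra).
  apply Rle_trans with (y ^ 2 * (1 - y ^ 2 / 2 + y ^ 4 / 24)).
  { apply Rmult_le_compat_l; lra. }
  apply Rle_trans with ((y - y ^ 3 / 6) ^ 2).
  + assert (0 <= y ^ 4 * (1 / 6 - y ^ 2 / 72)); [|nra].
    apply Rmult_le_pos; [apply pow_le; lra | lra].
  + apply pow_incr; split; [|exact Hs'].
    replace (y - y ^ 3 / 6) with (y * (1 - y ^ 2 / 6)) by field.
    apply Rmult_le_pos; lra.
- assert (cos y <= 0) by (apply cos_le_0; lra).
  assert (0 <= y ^ 2) by (apply pow2_ge_0).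
  assert (0 <= sin y ^ 2) by (apply pow2_ge_0).
  nra.
Qed.

(** What is left of [ln (tan x)] once its singularity at 0 is removed; it tends to 0 there. *)
Definition ln_tan_ratio (x : R) : R := ln (tan x) - ln x.

Lemma ln_tan_ratio_derive (x : R) : 0 < x < PI / 2 ->
  is_derive ln_tan_ratio x (/ (sin x * cos x) - / x).
Proof.
intros Hx.
assert (Hs : 0 < sin x) by (apply sin_gt_0; lra).
assert (Hc : 0 < cos x) by (apply cos_gt_0; lra).
assert (Ht : 0 < tan x) by (apply Rdiv_lt_0_compat; assumption).
unfold ln_tan_ratio, tan in *; auto_derive.
- repeat split; lra.
- assert (E := sin2_cos2 x); unfold Rsqr in E.
  revert Hs Hc E; generalize (sin x) (cos x); intros s c Hs Hc E.
  transitivity ((s * s + c * c) / (s * c) - / x); [field; lra | rewrite E; field; lra].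
Qed.

Lemma ln_tan_ratio_convex (x y : R) : 0 < x <= y -> y < PI / 2 ->
  / (sin x * cos x) - / x <= / (sin y * cos y) - / y.
Proof.
intros Hx Hy.
apply (is_derive_monotone (fun x => / (sin x * cos x) - / x)
  (fun x => - ((cos x) ^ 2 - (sin x) ^ 2) / (sin x * cos x) ^ 2 + / x ^ 2)); [lra| |].
- intros z Hz.
  assert (Hs : 0 < sin z) by (apply sin_gt_0; lra).
  assert (Hc : 0 < cos z) by (apply cos_gt_0; lra).
  assert (0 < sin z * cos z) by (apply Rmult_lt_0_compat; lra).
  auto_derive; [repeat split; lra | field; lra].
- intros z Hz.
  assert (Hs : 0 < sin z) by (apply sin_gt_0; lra).
  assert (Hc : 0 < cos z) by (apply cos_gt_0; lra).
  assert (H := sqr_cos_le (2 * z) ltac:(lra)).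
  rewrite sin_2a, cos_2a in H.
  replace (- (cos z ^ 2 - sin z ^ 2) / (sin z * cos z) ^ 2 + / z ^ 2) with
    (((2 * sin z * cos z) ^ 2 - (2 * z) ^ 2 * (cos z * cos z - sin z * sin z)) *
     / (4 * (sin z * cos z) ^ 2 * z ^ 2)) by (field; lra).
  apply Rmult_le_pos; [lra|].
  left; apply Rinv_0_lt_compat.
  repeat apply Rmult_lt_0_compat; try apply pow_lt; try lra; apply Rmult_lt_0_compat; lra.
Qed.

Lemma ln_tan_ratio_increment (x c : R) : 0 < x -> 0 < c -> x + c + c < PI / 2 ->
  ln_tan_ratio (x + c) - ln_tan_ratio x <= ln_tan_ratio (x + c + c) - ln_tan_ratio (x + c).
Proof.
intros Hx Hc Hxc.
apply (is_derive_monotone (fun x => ln_tan_ratio (x + c) - ln_tan_ratio x)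
  (fun x => (/ (sin (x + c) * cos (x + c)) - / (x + c)) - (/ (sin x * cos x) -
    / x)) x (x + c)); [lra| |].
- intros z Hz; apply (is_derive_minus (V := R_NormedModule)).
  + evar_last.
    * apply (is_derive_comp (V := R_NormedModule)); [apply ln_tan_ratio_derive; lra|].
      auto_derive; [exact I | reflexivity].
    * unfold scal; simpl; unfold mult; simpl; ring.
  + apply ln_tan_ratio_derive; lra.
- intros z Hz; generalize (ln_tan_ratio_convex z (z + c) ltac:(lra) ltac:(lra)); lra.
Qed.

Lemma ln_tan_ratio_small (x : R) : 0 < x < PI / 2 -> 0 <= ln_tan_ratio x <= - ln (cos x).
Proof.
intros Hx.
assert (Hs : 0 < sin x) by (apply sin_gt_0; lra).
assert (Hc : 0 < cos x) by (apply cos_gt_0; lra).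
assert (Hxs : sin x <= x).
{ generalize (abs_sin_le x); rewrite !Rabs_pos_eq; lra. }
assert (Ht : x * cos x <= sin x).
{ assert (H : sin 0 - 0 * cos 0 <= sin x - x * cos x).
  { apply (is_derive_monotone (fun x => sin x - x * cos x) (fun x => x * sin x) 0 x);
    [lra | |].
    - intros y _; auto_derive; [exact I | ring].
    - intros y Hy; apply Rmult_le_pos; [lra | apply sin_ge_0; lra]. }
  rewrite sin_0 in H; lra. }
assert (Hxc : 0 < x * cos x) by (apply Rmult_lt_0_compat; lra).
unfold ln_tan_ratio, tan; rewrite ln_div by assumption.
assert (Hl1 : ln (sin x) <= ln x) by (apply ln_le; assumption).
assert (Hl2 : ln (x * cos x) <= ln (sin x)) by (apply ln_le; assumption).
rewrite ln_mult in Hl2 by lra; lra.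
Qed.

(* Convexity sandwiches the sum of every other increment of [u] between
   halves of telescoping sums. *)
Lemma alternate_increments (u : nat -> R) (K : nat) :
  (forall j, (S (S j) <= 2 * K)%nat -> u (S j) - u j <= u (S (S j)) - u (S j)) ->
  2 * psum (fun k => u (2 * k + 1)%nat - u (2 * k)%nat) K <= u (2 * K)%nat - u 0%nat /\
  ((1 <= K)%nat -> u (2 * K - 1)%nat - u 0%nat + (u 1%nat - u 0%nat) <=
    2 * psum (fun k => u (2 * k + 1)%nat - u (2 * k)%nat) K).
Proof.
induction K as [|K IH]; intros H.
- simpl; split; [lra | lia].
- destruct IH as [IH1 IH2]; [intros; apply H; lia|].
  cbn [psum]; rewrite !Rmult_plus_distr_l; split.
  + assert (HK := H (2 * K)%nat ltac:(lia)).
    replace (2 * S K)%nat with (S (S (2 * K))) by lia.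
    replace (2 * K + 1)%nat with (S (2 * K)) by lia; lra.
  + intros _; replace (2 * S K - 1)%nat with (2 * K + 1)%nat by lia.
    destruct K as [|K]; [simpl; lra|].
    specialize (IH2 ltac:(lia)).
    assert (HK := H (2 * K + 1)%nat ltac:(lia)).
    replace (2 * S K - 1)%nat with (2 * K + 1)%nat in IH2 by lia.
    replace (S (S (2 * K + 1))) with (2 * S K + 1)%nat in HK by lia.
    replace (S (2 * K + 1)) with (2 * S K)%nat in HK by lia.
    lra.
Qed.

Lemma is_lim_seq_div_INR (c : R) : is_lim_seq (fun n => c / INR n) 0.
Proof.
replace (Finite 0) with (Finite (c * 0)) by (f_equal; ring).
apply is_lim_seq_mult'; [apply is_lim_seq_const|].
replace (Finite 0) with (Rbar_inv p_infty) by reflexivity.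
apply is_lim_seq_inv; [apply is_lim_seq_INR | discriminate].
Qed.

(** Replacing each tangent by its argument changes the sum by the increments of [ln_tan_ratio] over
    every other cell of a uniform grid. By convexity these cells carry, in the limit, half of the
    total increment from 0 to [PI/4], which is [ln (4/PI)]. *)
Lemma wave_block_sum_lim :
  is_lim_seq (fun K => psum (wave_block K) K -
    psum (fun k => ln ((4 * INR k + 3) / (4 * INR k + 1))) K) (ln (4 / PI) / 2).
Proof.
assert (HPI := PI_RGT_0).
set (h := fun K => PI / 16 / INR K).
assert (Hh : is_lim_seq h 0) by apply is_lim_seq_div_INR.
assert (Hhb : forall K, (1 <= K)%nat -> 0 < h K <= PI / 16 /\ 4 * INR K * h K = PI / 4).
{ intros K HK; assert (1 <= INR K) by (apply (le_INR 1); exact HK).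
  unfold h; split; [split|].
  - apply Rdiv_lt_0_compat; lra.
  - apply (Rmult_le_reg_r (INR K)); [lra|].
    unfold Rdiv at 1; rewrite Rmult_assoc, Rinv_l by lra; nra.
  - field; lra. }
assert (L0 : forall c, 0 < c <= 4 -> is_lim_seq (fun K => ln_tan_ratio (c * h K)) 0).
{ intros c Hc.
  assert (Hch : is_lim_seq (fun K => c * h K) 0).
  { replace (Finite 0) with (Finite (c * 0)) by (f_equal; ring).
    apply is_lim_seq_mult'; [apply is_lim_seq_const | exact Hh]. }
  apply is_lim_seq_le_le_loc with (u := fun _ => 0) (w := fun K => - ln (cos (c * h K))).
  - exists 1%nat; intros K HK; destruct (Hhb K HK) as [H1 H2].
    apply ln_tan_ratio_small; nra.
  - apply is_lim_seq_const.
  - assert (Hl : is_lim_seq (fun K => - ln (cos (c * h K))) (- ln (cos 0))).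
    { apply (is_lim_seq_continuous (fun x => - ln (cos x)) (fun K => c * h K) 0); [|exact Hch].
      apply continuity_pt_filterlim.
      apply (ex_derive_continuous (V := R_NormedModule) (fun x => - ln (cos x)) 0).
      auto_derive; rewrite cos_0; lra. }
    rewrite cos_0, ln_1, Ropp_0 in Hl; exact Hl. }
assert (L4 : forall e, is_lim_seq (fun K => ln_tan_ratio (PI / 4 + e * h K)) (ln (4 / PI))).
{ intros e.
  assert (Hch : is_lim_seq (fun K => PI / 4 + e * h K) (PI / 4)).
  { evar_last.
    - apply is_lim_seq_plus'; [apply is_lim_seq_const|].
      apply is_lim_seq_mult'; [apply is_lim_seq_const | exact Hh].
    - f_equal; ring. }
  replace (ln (4 / PI)) with (ln_tan_ratio (PI / 4)).
  - apply is_lim_seq_continuous; [|exact Hch].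
    apply continuity_pt_filterlim, (ex_derive_continuous (V := R_NormedModule)).
    eexists; apply ln_tan_ratio_derive; lra.
  - unfold ln_tan_ratio; rewrite tan_PI4, ln_1, !ln_div by lra; ring. }
(* The nodes are odd multiples of [h K], so the cells have width [2 * h K]. The last node used,
   [j = 2 * K], lies [h K] beyond [PI/4], still below [PI/2]. *)
set (u := fun K j => ln_tan_ratio ((2 * INR j + 1) * h K)).
assert (E : forall K, (1 <= K)%nat -> psum (wave_block K) K -
    psum (fun k => ln ((4 * INR k + 3) / (4 * INR k + 1))) K =
    psum (fun k => u K (2 * k + 1)%nat - u K (2 * k)%nat) K).
{ intros K HK; destruct (Hhb K HK) as [H1 H2].
  assert (HK0 : 0 < INR K) by (apply lt_0_INR; lia).
  rewrite <- psum_minus; apply psum_ext; intros k.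
  assert (Hk := pos_INR k).
  unfold wave_block, u, ln_tan_ratio.
  rewrite plus_INR, mult_INR; simpl (INR 2); simpl (INR 1).
  replace ((4 * INR k + 3) * PI / (16 * INR K)) with ((4 * INR k + 3) * h K) by (unfold h;
    field; lra).
  replace ((4 * INR k + 1) * PI / (16 * INR K)) with ((4 * INR k + 1) * h K) by (unfold h;
    field; lra).
  replace (2 * ((1 + 1) * INR k + 1) + 1) with (4 * INR k + 3) by ring.
  replace (2 * ((1 + 1) * INR k) + 1) with (4 * INR k + 1) by ring.
  rewrite ln_div, !ln_mult by lra; ring. }
assert (B : forall K, (1 <= K)%nat ->
  2 * psum (fun k => u K (2 * k + 1)%nat - u K (2 * k)%nat) K <= u K (2 * K)%nat - u K 0%nat /\
  u K (2 * K - 1)%nat - u K 0%nat + (u K 1%nat - u K 0%nat) <=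
    2 * psum (fun k => u K (2 * k + 1)%nat - u K (2 * k)%nat) K).
{ intros K HK; destruct (Hhb K HK) as [H1 H2].
  destruct (alternate_increments (u K) K) as [A1 A2]; [|split; [exact A1 | exact (A2 HK)]].
  intros j Hj; unfold u; rewrite !S_INR.
  assert (Hj0 := pos_INR j).
  assert (HjK : INR j + 2 <= 2 * INR K).
  { apply le_INR in Hj; rewrite !S_INR, mult_INR in Hj; simpl in Hj; lra. }
  replace ((2 * (INR j + 1) + 1) * h K) with ((2 * INR j + 1) * h K + 2 * h K) by ring.
  replace ((2 * (INR j + 1 + 1) + 1) * h K)
    with ((2 * INR j + 1) * h K + 2 * h K + 2 * h K) by ring.
  apply ln_tan_ratio_increment; [nra | lra | nra]. }
assert (Eu : forall K, (1 <= K)%nat -> u K (2 * K)%nat = ln_tan_ratio (PI / 4 + 1 * h K) /\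
  u K (2 * K - 1)%nat = ln_tan_ratio (PI / 4 + (-1) * h K) /\
  u K 0%nat = ln_tan_ratio (1 * h K) /\ u K 1%nat = ln_tan_ratio (3 * h K)).
{ intros K HK; destruct (Hhb K HK) as [H1 H2]; unfold u; repeat split; f_equal.
  - rewrite mult_INR; simpl; lra.
  - rewrite minus_INR, mult_INR by lia; simpl; lra.
  - simpl; ring.
  - simpl; ring. }
apply is_lim_seq_le_le_loc with
  (u := fun K => (ln_tan_ratio (PI / 4 + (-1) * h K) - ln_tan_ratio (1 * h K) +
     (ln_tan_ratio (3 * h K) - ln_tan_ratio (1 * h K))) * / 2)
  (w := fun K => (ln_tan_ratio (PI / 4 + 1 * h K) - ln_tan_ratio (1 * h K)) * / 2).
- exists 1%nat; intros K HK; rewrite E by exact HK.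
  destruct (B K HK) as [B1 B2]; destruct (Eu K HK) as [E1 [E2 [E3 E4]]].
  rewrite E1, E3 in B1; rewrite E2, E3, E4 in B2; lra.
- replace (ln (4 / PI) / 2) with ((ln (4 / PI) - 0 + (0 - 0)) * / 2) by field.
  apply is_lim_seq_mult'; [|apply is_lim_seq_const].
  apply is_lim_seq_plus'; apply is_lim_seq_minus'; try apply L4; apply L0; lra.
- replace (ln (4 / PI) / 2) with ((ln (4 / PI) - 0) * / 2) by field.
  apply is_lim_seq_mult'; [|apply is_lim_seq_const].
  apply is_lim_seq_minus'; [apply L4 | apply L0; lra].
Qed.

Lemma even_subseq_lim (u : nat -> R) (l : R) :
  is_lim_seq u l -> is_lim_seq (fun n => u (2 * n)%nat) l.
Proof.
intros H; apply (is_lim_seq_subseq u l (fun n => (2 * n)%nat)); [|exact H].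
intros P [N HN]; exists N; intros n Hn; apply HN; lia.
Qed.

(** Two successive limits: the number of terms grows at fixed [K], which brings in [S] with an error
    [1/K], and then [K] grows. The constant comes from [3/2 ln 2 - ln (4/PI) / 2 = ln (2 PI) / 2].
    Even partial sums suit the paired form in which [S] is obtained later. *)
Lemma log_quotient_lim (S : R) :
  is_lim_seq (fun M => psum (fun n => alt n / odd n * ln (odd n)) (2 * M)) S ->
  is_lim_seq (fun K => psum (fun k => ln ((4 * INR k + 3) / (4 * INR k + 1))) K -
    ln (INR K) / 2)
    (2 / PI * S + (euler_gamma + ln (2 * PI)) / 2).
Proof.
intros HS; assert (HPI := PI_RGT_0).
assert (B : forall K, (1 <= K)%nat ->
  Rabs (PI / 4 * psum (wave_block K) K -
    ((ln (2 * INR K) / 2 + ln 2 + euler_gamma / 2) * (PI / 4) + / 2 * S)) <= / INR K).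
{ intros K HK.
  refine (is_lim_seq_le (fun M => Rabs (psum (fun n => alt n / odd n * oddharm (2 * K * (2 * n
    + 1))) (2 * M) -
    ((ln (2 * INR K) / 2 + ln 2 + euler_gamma / 2) * leibniz (2 * M) +
     / 2 * psum (fun n => alt n / odd n * ln (odd n)) (2 * M)))) (fun _ => / INR K)
     (Finite _) (Finite _) _ _ (is_lim_seq_const _)).
  - intros M; apply wave_sum_error; exact HK.
  - apply (is_lim_seq_abs _ (Finite _)), is_lim_seq_minus'.
    + apply (even_subseq_lim (psum (fun n => alt n / odd n * oddharm (2 * K * (2 * n + 1))))).
      apply wave_identity, lt_0_INR; lia.
    + apply is_lim_seq_plus'; apply is_lim_seq_mult'; try apply is_lim_seq_const.
      * apply (even_subseq_lim leibniz), leibniz_lim.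
      * exact HS. }
assert (L : is_lim_seq (fun K => psum (wave_block K) K - ln (INR K) / 2)
  (2 / PI * S + 3 / 2 * ln 2 + euler_gamma / 2)).
{ apply is_lim_seq_le_le_loc with
    (u := fun K => 2 / PI * S + 3 / 2 * ln 2 + euler_gamma / 2 - 4 / PI / INR K)
    (w := fun K => 2 / PI * S + 3 / 2 * ln 2 + euler_gamma / 2 + 4 / PI / INR K).
  - exists 1%nat; intros K HK; specialize (B K HK).
    assert (HK0 : 0 < INR K) by (apply lt_0_INR; lia).
    rewrite ln_mult in B by lra.
    set (R := psum (wave_block K) K) in *.
    assert (H4 : 0 < 4 / PI) by (apply Rdiv_lt_0_compat; lra).
    assert (B' : Rabs (R - ln (INR K) / 2 -
      (2 / PI * S + 3 / 2 * ln 2 + euler_gamma / 2)) <= 4 / PI * / INR K).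
    { replace (R - ln (INR K) / 2 - (2 / PI * S + 3 / 2 * ln 2 + euler_gamma / 2)) with
       (4 / PI * (PI / 4 * R - (((ln 2 + ln (INR K)) / 2 + ln 2 + euler_gamma / 2) * (PI / 4)
         + / 2 * S)))
       by (field; lra).
      rewrite Rabs_mult, (Rabs_pos_eq (4 / PI)) by lra.
      apply Rmult_le_compat_l; [lra | exact B]. }
    apply Rabs_le_between in B'; unfold Rdiv in *; lra.
  - replace (Finite (2 / PI * S + 3 / 2 * ln 2 + euler_gamma / 2)) with
      (Finite (2 / PI * S + 3 / 2 * ln 2 + euler_gamma / 2 - 0)) by (f_equal; ring).
    apply is_lim_seq_minus'; [apply is_lim_seq_const | apply is_lim_seq_div_INR].
  - replace (Finite (2 / PI * S + 3 / 2 * ln 2 + euler_gamma / 2)) with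
      (Finite (2 / PI * S + 3 / 2 * ln 2 + euler_gamma / 2 + 0)) by (f_equal; ring).
    apply is_lim_seq_plus'; [apply is_lim_seq_const | apply is_lim_seq_div_INR]. }
assert (L2 := is_lim_seq_minus' _ _ _ _ L wave_block_sum_lim).
replace (2 / PI * S + (euler_gamma + ln (2 * PI)) / 2) with
  (2 / PI * S + 3 / 2 * ln 2 + euler_gamma / 2 - ln (4 / PI) / 2).
- apply is_lim_seq_ext with (2 := L2); intros K; ring.
- rewrite ln_div, ln_mult by lra.
  replace (ln 4) with (2 * ln 2); [field; lra|].
  replace 4 with (2 * 2) by ring; rewrite ln_mult by lra; ring.
Qed.

(** * Euler's integral and Wallis's product *)

Definition euler_integrand (x t : R) : R := Rpower t (x - 1) * exp (- t).

(** Relational form of Euler's integral: it asserts convergence, whereas [Gamma] is a total function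
    whose value is meaningful only once convergence is known. *)
Definition is_Gamma (x l : R) : Prop :=
  is_RInt_gen (euler_integrand x) (at_right 0) (Rbar_locally p_infty) l.

Lemma at_right_0_lt (c : R) : 0 < c -> at_right 0 (fun a => 0 < a < c).
Proof.
intros Hc; exists (mkposreal c Hc); intros a Ha H0; split; [exact H0|].
unfold ball in Ha; simpl in Ha; unfold AbsRing_ball, abs, minus, plus, opp in Ha; simpl in Ha.
apply Rabs_def2 in Ha; lra.
Qed.

Lemma filter_prod_pos (P : R * R -> Prop) :
  (forall a b, 0 < a -> a <= b -> P (a, b)) ->
  filter_prod (at_right 0) (Rbar_locally p_infty) P.
Proof.
intros H; apply Filter_prod with (Q := fun a => 0 < a < 1) (R := fun b => 1 < b).
- apply at_right_0_lt; lra.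
- exists 1; auto.
- intros a b Ha Hb; apply H; lra.
Qed.

Lemma filter_prod_pos_between (P : R -> Prop) :
  (forall t, 0 < t -> P t) ->
  filter_prod (at_right 0) (Rbar_locally p_infty)
    (fun ab => forall t, Rmin (fst ab) (snd ab) <= t <= Rmax (fst ab) (snd ab) -> P t).
Proof.
intros H; apply filter_prod_pos; simpl; intros a b Ha Hab t.
rewrite Rmin_left, Rmax_right by exact Hab; intros Ht; apply H; lra.
Qed.

(** For a nonnegative integrand the proper integrals grow with the interval, so their supremum is
    the improper integral. *)
Lemma ex_RInt_gen_nonneg (f : R -> R) (B : R) :
  (forall t, 0 < t -> continuous f t) -> (forall t, 0 < t -> 0 <= f t) ->
  (forall a b, 0 < a <= b -> RInt f a b <= B) ->
  exists l, is_RInt_gen f (at_right 0) (Rbar_locally p_infty) l.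
Proof.
intros Hc Hp HB.
assert (Hex : forall a b, 0 < a <= b -> ex_RInt f a b).
{ intros a b Hab; apply (ex_RInt_continuous (V := R_CompleteNormedModule)); intros t.
  rewrite Rmin_left, Rmax_right by lra; intros Ht; apply Hc; lra. }
assert (Hmono : forall a b a' b', 0 < a' <= a -> a <= b <= b' -> RInt f a b <= RInt f a' b').
{ intros a b a' b' Ha Hb.
  assert (E1 := RInt_Chasles (V := R_CompleteNormedModule) f a' a b' (Hex a' a ltac:(lra))
    (Hex a b' ltac:(lra))).
  assert (E2 := RInt_Chasles (V := R_CompleteNormedModule) f a b b' (Hex a b ltac:(lra))
    (Hex b b' ltac:(lra))).
  unfold plus in E1, E2; simpl in E1, E2; rewrite <- E1, <- E2.
  assert (I1 : 0 <= RInt f a' a) by (apply RInt_ge_0; [lra | apply Hex; lra | intros;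
    apply Hp; lra]).
  assert (I2 : 0 <= RInt f b b') by (apply RInt_ge_0; [lra | apply Hex; lra | intros;
    apply Hp; lra]).
  lra. }
destruct (completeness (fun y => exists a b, 0 < a <= b /\ y = RInt f a b)) as [l [Hl1 Hl2]].
{ exists B; intros y [a [b [Hab ->]]]; apply HB; exact Hab. }
{ exists (RInt f 1 1), 1, 1; split; [lra | reflexivity]. }
exists l; intros P [eps HP].
destruct eps as [eps Heps]; simpl in HP.
assert (Hnear : exists a b, 0 < a <= b /\ l - eps < RInt f a b).
{ apply Classical_Prop.NNPP; intros Hn.
  assert (Hub : is_upper_bound (fun y => exists a b, 0 < a <= b /\ y = RInt f a b) (l - eps)).
  { intros y [a [b [Hab ->]]]; apply Rnot_lt_le; intros Hlt; apply Hn; exists a, b; auto. }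
  specialize (Hl2 _ Hub); lra. }
destruct Hnear as [a0 [b0 [Hab0 Hlt]]].
apply Filter_prod with (Q := fun a => 0 < a < a0) (R := fun b => b0 < b).
- apply at_right_0_lt; lra.
- exists b0; auto.
- intros a b Ha Hb; simpl; exists (RInt f a b); split.
  + apply (RInt_correct (V := R_CompleteNormedModule)), Hex; lra.
  + apply HP.
    assert (RInt f a b <= l) by (apply Hl1; exists a, b; split; [lra | reflexivity]).
    assert (RInt f a0 b0 <= RInt f a b) by (apply Hmono; lra).
    change (Rabs (RInt f a b - l) < eps); apply Rabs_def1; lra.
Qed.

Lemma exp_le_mono (x y : R) : x <= y -> exp x <= exp y.
Proof. intros [H | ->]; [left; apply exp_increasing; exact H | right; reflexivity]. Qed.

Lemma exp_ge_sqr (t : R) : 0 <= t -> (1 + t) ^ 2 <= 4 * exp t.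
Proof.
intros Ht; replace t with (t / 2 + t / 2) at 2 by field; rewrite exp_plus.
assert (H := exp_ineq1_le (t / 2)); nra.
Qed.

Lemma euler_integrand_pos (x t : R) : 0 < euler_integrand x t.
Proof. apply Rmult_lt_0_compat; [apply exp_pos | apply exp_pos]. Qed.

Lemma is_derive_Rpower (y t : R) : 0 < t ->
  is_derive (fun t => Rpower t y) t (y * Rpower t (y - 1)).
Proof.
intros Ht.
replace (Rpower t (y - 1)) with (Rpower t y * / t).
- unfold Rpower; auto_derive; [exact Ht | ring].
- unfold Rminus; rewrite Rpower_plus, Rpower_Ropp, Rpower_1 by exact Ht; reflexivity.
Qed.

Lemma euler_integrand_continuous (x t : R) : 0 < t -> continuous (euler_integrand x) t.
Proof.
intros Ht; apply (ex_derive_continuous (V := R_NormedModule)).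
unfold euler_integrand, Rpower; auto_derive; exact Ht.
Qed.

(* [t^(x-1) e^(-t)] is dominated by [4/x] times the derivative of
   [(t / (1 + t))^x]. *)
Lemma is_Gamma_ex (x : R) : 0 < x <= 1 -> exists l, is_Gamma x l.
Proof.
intros Hx.
apply (ex_RInt_gen_nonneg _ (4 / x)).
- intros t Ht; apply euler_integrand_continuous; exact Ht.
- intros t _; left; apply euler_integrand_pos.
- intros a b Hab.
  set (G := fun t => 4 / x * Rpower (t / (1 + t)) x).
  set (g := fun t => 4 * Rpower (t / (1 + t)) (x - 1) * / (1 + t) ^ 2).
  assert (HG : forall t, 0 < t -> is_derive G t (g t)).
  { intros t Ht; unfold G, g.
    assert (Hq : 0 < t / (1 + t)) by (apply Rdiv_lt_0_compat; lra).
    evar_last.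
    - apply (is_derive_scal (fun t => Rpower (t / (1 + t)) x)).
      apply (is_derive_comp (V := R_NormedModule) (fun y => Rpower y x)).
      + apply is_derive_Rpower; exact Hq.
      + auto_derive; [lra | reflexivity].
    - unfold scal; simpl; unfold mult; simpl; field; lra. }
  assert (Hg : forall t, 0 < t -> continuous g t).
  { intros t Ht; assert (Hq : 0 < t / (1 + t)) by (apply Rdiv_lt_0_compat; lra).
    apply (ex_derive_continuous (V := R_NormedModule)); unfold g, Rpower; auto_derive.
    split; [lra|]; split; [exact Hq|]; split; [|exact I].
    apply Rgt_not_eq; apply Rmult_lt_0_compat; lra. }
  assert (Hig : is_RInt g a b (G b - G a)).
  { apply (is_RInt_derive (V := R_CompleteNormedModule)); rewrite Rmin_left, Rmax_right by lra;
      intros t Ht; [apply HG | apply Hg]; lra. }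
  apply Rle_trans with (RInt g a b).
  + apply RInt_le; [lra | | exists (G b - G a); exact Hig |].
    * apply (ex_RInt_continuous (V := R_CompleteNormedModule)); rewrite Rmin_left,
      Rmax_right by lra.
      intros t Ht; apply euler_integrand_continuous; lra.
    * intros t Ht; unfold g, euler_integrand.
      (* Here [x <= 1] enters: a nonpositive exponent reverses [t / (1 + t) <= t]. *)
      assert (H1 : Rpower t (x - 1) <= Rpower (t / (1 + t)) (x - 1)).
      { unfold Rpower.
        assert (Hl : ln (t / (1 + t)) <= ln t).
        { apply ln_le; [apply Rdiv_lt_0_compat; lra|].
          apply (Rmult_le_reg_r (1 + t)); [lra|].
          unfold Rdiv; rewrite Rmult_assoc, Rinv_l by lra; nra. }
        assert (Hm : (x - 1) * ln t <= (x - 1) * ln (t / (1 + t))) by nra.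
        apply exp_le_mono; exact Hm. }
      assert (H2 : exp (- t) <= 4 * / (1 + t) ^ 2).
      { assert (H := exp_ge_sqr t ltac:(lra)).
        assert (H0 : 0 < (1 + t) ^ 2) by (apply pow_lt; lra).
        rewrite exp_Ropp.
        apply (Rmult_le_reg_r (exp t)); [apply exp_pos|].
        rewrite Rinv_l by (generalize (exp_pos t); lra).
        apply (Rmult_le_reg_r ((1 + t) ^ 2)); [exact H0|].
        replace (4 * / (1 + t) ^ 2 * exp t * (1 + t) ^ 2) with (4 * exp t) by (field; lra);
          lra. }
      replace (4 * Rpower (t / (1 + t)) (x - 1) * / (1 + t) ^ 2) with
        (Rpower (t / (1 + t)) (x - 1) * (4 * / (1 + t) ^ 2)) by ring.
      apply Rmult_le_compat; [left; apply exp_pos | left; apply exp_pos | exact H1 | exact H2].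
  + rewrite (is_RInt_unique _ _ _ _ Hig); unfold G.
    assert (Hx4 : 0 < 4 / x) by (apply Rdiv_lt_0_compat; lra).
    assert (0 < Rpower (a / (1 + a)) x) by apply exp_pos.
    assert (Rpower (b / (1 + b)) x <= 1).
    { assert (Hl : ln (b / (1 + b)) <= 0).
      { rewrite <- ln_1; apply ln_le; [apply Rdiv_lt_0_compat; lra|].
        apply (Rmult_le_reg_r (1 + b)); [lra|].
        unfold Rdiv; rewrite Rmult_assoc, Rinv_l by lra; lra. }
      assert (Hm : x * ln (b / (1 + b)) <= 0) by nra.
      unfold Rpower; rewrite <- exp_0 at 2.
      apply exp_le_mono; exact Hm. }
    nra.
Qed.

Lemma power_exp_lim_0 (x : R) : 0 < x ->
  filterlim (fun t => - (Rpower t x * exp (- t))) (at_right 0) (locally 0).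
Proof.
intros Hx; apply filterlim_locally; intros [eps Heps].
(* The radius [exp (ln eps / x)] is [eps^(1/x)]. *)
apply filter_imp with (2 := at_right_0_lt (exp (ln eps / x)) (exp_pos _)).
intros t [H0 Ht]; change (Rabs (- (Rpower t x * exp (- t)) - 0) < eps).
rewrite Rminus_0_r, Rabs_Ropp, Rabs_pos_eq by (left; apply Rmult_lt_0_compat; apply exp_pos).
apply Rle_lt_trans with (Rpower t x * 1).
- apply Rmult_le_compat_l; [left; apply exp_pos|].
  rewrite <- exp_0; left; apply exp_increasing; lra.
- rewrite Rmult_1_r; unfold Rpower; rewrite <- (exp_ln eps) by exact Heps.
  apply exp_increasing.
  apply ln_increasing in Ht; [|exact H0]; rewrite ln_exp in Ht.
  apply (Rmult_lt_compat_l x) in Ht; [|exact Hx].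
  replace (x * (ln eps / x)) with (ln eps) in Ht by (field; lra); exact Ht.
Qed.

Lemma power_exp_lim_infty (x : R) : 0 < x ->
  filterlim (fun t => - (Rpower t x * exp (- t))) (Rbar_locally p_infty) (locally 0).
Proof.
intros Hx; apply filterlim_locally; intros [eps Heps].
(* [C = (2x)^x] bounds [t^x exp (-t/2)], by [ln y <= y - 1] at [y = t / (2x)]. The other half of the
   exponential is beaten by [1 + t/2]. *)
set (C := exp (x * ln (2 * x))).
assert (HC : 0 < C) by apply exp_pos.
exists (Rmax 1 (2 * C / eps)); intros t Ht.
assert (H1 : 1 < t) by (eapply Rle_lt_trans; [apply Rmax_l | exact Ht]).
assert (H2 : 2 * C / eps < t) by (eapply Rle_lt_trans; [apply Rmax_r | exact Ht]).
change (Rabs (- (Rpower t x * exp (- t)) - 0) < eps).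
rewrite Rminus_0_r, Rabs_Ropp, Rabs_pos_eq by (left; apply Rmult_lt_0_compat; apply exp_pos).
assert (Hb : Rpower t x * exp (- t) <= C * exp (- (t / 2))).
{ unfold Rpower, C; rewrite <- !exp_plus.
  assert (Hm : x * ln t + - t <= x * ln (2 * x) + - (t / 2)).
  { assert (Hl := ln_le_sub_1 (t / (2 * x)) ltac:(apply Rdiv_lt_0_compat; lra)).
    rewrite ln_div in Hl by lra.
    apply (Rmult_le_compat_l x) in Hl; [|lra].
    replace (x * (t / (2 * x) - 1)) with (t / 2 - x) in Hl by (field; lra); lra. }
  apply exp_le_mono; exact Hm. }
eapply Rle_lt_trans; [exact Hb|].
rewrite exp_Ropp.
assert (He := exp_ineq1_le (t / 2)).
apply (Rmult_lt_reg_r (exp (t / 2))); [apply exp_pos|].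
rewrite Rmult_assoc, Rinv_l, Rmult_1_r by lra.
apply (Rmult_lt_compat_r eps) in H2; [|exact Heps].
replace (2 * C / eps * eps) with (2 * C) in H2 by (field; lra).
nra.
Qed.

Lemma is_RInt_gen_antideriv (f F : R -> R) (la lb : R) :
  (forall t, 0 < t -> is_derive F t (f t)) ->
  (forall t, 0 < t -> continuous f t) ->
  filterlim F (at_right 0) (locally la) ->
  filterlim F (Rbar_locally p_infty) (locally lb) ->
  is_RInt_gen f (at_right 0) (Rbar_locally p_infty) (lb - la).
Proof.
intros HF Hf Ha Hb.
apply (is_RInt_gen_ext (V := R_NormedModule) (Derive F)).
- apply filter_prod_pos; simpl; intros a b Ha' Hab t; rewrite Rmin_left by exact Hab.
  intros Ht; apply is_derive_unique, HF; lra.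
- apply is_RInt_gen_Derive; [| | exact Ha | exact Hb].
  + apply filter_prod_pos_between; intros t Ht; exists (f t); apply HF; exact Ht.
  + apply filter_prod_pos_between; intros t Ht.
    apply (continuous_ext_loc _ f); [|apply Hf; exact Ht].
    exists (mkposreal t Ht); intros s Hs; symmetry; apply is_derive_unique, HF.
    unfold ball in Hs; simpl in Hs; unfold AbsRing_ball, abs, minus, plus, opp in Hs;
      simpl in Hs.
    apply Rabs_def2 in Hs; lra.
Qed.

(** Integration by parts: [euler_integrand (x + 1) - x * euler_integrand x] is the derivative of
    [- t^x exp (-t)], which vanishes at both ends. *)
Lemma is_Gamma_succ (x l : R) : 0 < x -> is_Gamma x l -> is_Gamma (x + 1) (x * l).
Proof.
intros Hx Hl.
assert (H0 : is_RInt_gen (fun t => euler_integrand (x + 1) t - x * euler_integrand x t)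
  (at_right 0) (Rbar_locally p_infty) (0 - 0)).
{ apply (is_RInt_gen_antideriv _ (fun t => - (Rpower t x * exp (- t)))).
  - intros t Ht.
    evar_last.
    + apply (is_derive_opp (V := R_NormedModule) (fun t => Rpower t x * exp (- t))).
      apply (is_derive_mult (fun t => Rpower t x) (fun t => exp (- t))).
      * apply is_derive_Rpower; exact Ht.
      * auto_derive; [exact I | reflexivity].
      * intros; apply Rmult_comm.
    + unfold euler_integrand; replace (x + 1 - 1) with x by ring.
      unfold opp, plus, mult; simpl; ring.
  - intros t Ht; apply (continuous_minus (V := R_NormedModule)).
    + apply euler_integrand_continuous; exact Ht.
    + apply (continuous_scal_r (V := R_NormedModule)), euler_integrand_continuous; exact Ht.
  - apply power_exp_lim_0; exact Hx.
  - apply power_exp_lim_infty; exact Hx. }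
assert (H1 := is_RInt_gen_plus (V := R_NormedModule) _ _ _ _ H0 (is_RInt_gen_scal (V :=
  R_NormedModule) _ x _ Hl)).
unfold is_Gamma.
replace (x * l) with (plus (0 - 0) (scal x l)) by (unfold plus, scal; simpl; unfold mult;
  simpl; ring).
apply (is_RInt_gen_ext (V := R_NormedModule)) with (2 := H1).
apply filter_prod_pos; simpl; intros a b _ _ t _.
unfold plus, scal; simpl; unfold mult; simpl; ring.
Qed.

Lemma is_Gamma_1 : is_Gamma 1 1.
Proof.
unfold is_Gamma; replace 1 with (0 - - 1) at 2 by ring.
apply (is_RInt_gen_antideriv _ (fun t => - exp (- t))).
- intros t Ht; unfold euler_integrand; rewrite Rminus_diag, Rpower_O by exact Ht.
  auto_derive; [exact I | ring].
- intros t Ht; apply euler_integrand_continuous; exact Ht.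
- replace (- 1) with (- exp (- 0)) by (rewrite Ropp_0, exp_0; reflexivity).
  eapply filterlim_filter_le_1; [apply filter_le_within|].
  apply (ex_derive_continuous (V := R_NormedModule) (fun t => - exp (- t)) 0); auto_derive;
    exact I.
- apply filterlim_locally; intros [eps Heps].
  exists (/ eps); intros t Ht.
  assert (Hi : 0 < / eps) by (apply Rinv_0_lt_compat; exact Heps).
  change (Rabs (- exp (- t) - 0) < eps).
  rewrite Rminus_0_r, Rabs_Ropp, Rabs_pos_eq, exp_Ropp by (left; apply exp_pos).
  rewrite <- (Rinv_inv eps); apply Rinv_lt_contravar.
  + apply Rmult_lt_0_compat; [exact Hi | apply exp_pos].
  + generalize (exp_ineq1_le t); lra.
Qed.

(** With [r^al] factored out, 1 and [r] become [exp (- al ln r)] and [exp ((1 - al) ln r)]. In the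
    weighted sum of their bounds [exp y >= 1 + y] the logarithms cancel. *)
Lemma Rpower_tangent (r al : R) : 0 < r -> 0 <= al <= 1 -> Rpower r al <= 1 - al + al * r.
Proof.
intros Hr Hal.
assert (H1 := exp_ineq1_le ((1 - al) * ln r)).
assert (H2 := exp_ineq1_le (- al * ln r)).
assert (E1 : Rpower r al * exp ((1 - al) * ln r) = r).
{ unfold Rpower; rewrite <- exp_plus.
  replace (al * ln r + (1 - al) * ln r) with (ln r) by ring; apply exp_ln; exact Hr. }
assert (E2 : Rpower r al * exp (- al * ln r) = 1).
{ unfold Rpower; rewrite <- exp_plus.
  replace (al * ln r + - al * ln r) with 0 by ring; apply exp_0. }
assert (Hp : 0 < Rpower r al) by apply exp_pos.
rewrite <- E1 at 2; rewrite <- (Rmult_1_r (1 - al)), <- E2 at 1.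
assert (Rpower r al * (1 + (1 - al) * ln r) <= Rpower r al * exp ((1 - al) * ln r))
  by (apply Rmult_le_compat_l; lra).
assert (Rpower r al * (1 + - al * ln r) <= Rpower r al * exp (- al * ln r))
  by (apply Rmult_le_compat_l; lra).
nra.
Qed.

(* Integrates the tangent bound [(t/x)^al <= 1 - al + al t/x]; this stands in
   for the log-convexity of Gamma. *)
Lemma is_Gamma_shift_le (x al l m : R) : 0 < x -> 0 <= al <= 1 ->
  is_Gamma x l -> is_Gamma (x + al) m -> m <= Rpower x al * l.
Proof.
intros Hx Hal Hl Hm.
assert (H1 := is_RInt_gen_plus (V := R_NormedModule) _ _ _ _
   (is_RInt_gen_scal (V := R_NormedModule) _ (Rpower x al * (1 - al)) _ Hl)
   (is_RInt_gen_scal (V := R_NormedModule) _ (Rpower x al * (al / x)) _ (is_Gamma_succ x l Hx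
     Hl))).
replace (Rpower x al * l) with (plus (scal (Rpower x al * (1 - al)) l)
  (scal (Rpower x al * (al / x)) (x * l)))
  by (unfold plus, scal; simpl; unfold mult; simpl; field; lra).
eapply Rle_trans; [apply Rle_abs|].
refine (RInt_gen_norm (V := R_CompleteNormedModule) _ _ _ _ _ _ Hm H1).
- apply filter_prod_pos; simpl; intros; assumption.
- apply filter_prod_pos; simpl; intros a b Ha Hab t Ht.
  unfold norm; simpl; unfold abs; simpl.
  rewrite Rabs_pos_eq by (left; apply euler_integrand_pos).
  unfold plus, scal; simpl; unfold mult; simpl; unfold euler_integrand.
  assert (Ht0 : 0 < t) by lra.
  replace (x + al - 1) with (al + (x - 1)) by ring.
  replace (x + 1 - 1) with (1 + (x - 1)) by ring.
  rewrite !Rpower_plus, Rpower_1 by exact Ht0.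
  assert (E : Rpower t al = Rpower x al * Rpower (t / x) al).
  { rewrite Rpower_mult_distr; [f_equal; field; lra | exact Hx | apply Rdiv_lt_0_compat;
    lra]. }
  assert (Htan := Rpower_tangent (t / x) al ltac:(apply Rdiv_lt_0_compat; lra) Hal).
  rewrite E.
  assert (P1 : 0 < Rpower x al) by apply exp_pos.
  assert (P2 : 0 < Rpower t (x - 1) * exp (- t)) by (apply Rmult_lt_0_compat; apply exp_pos).
  replace (Rpower x al * (1 - al) * (Rpower t (x - 1) * exp (- t)) +
    Rpower x al * (al / x) * (t * Rpower t (x - 1) * exp (- t))) with
    (Rpower x al * (1 - al + al * (t / x)) * (Rpower t (x - 1) * exp (- t))) by (field; lra).
  rewrite (Rmult_assoc _ (Rpower t (x - 1)) (exp (- t))).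
  apply Rmult_le_compat_r; [lra|]; apply Rmult_le_compat_l; [lra | exact Htan].
Qed.

Definition lnfact (n : nat) : R := ln (INR (fact n)).

Lemma fact_pos (n : nat) : 0 < INR (fact n).
Proof. apply lt_0_INR, lt_O_fact. Qed.

Lemma lnfact_S (n : nat) : lnfact (S n) = lnfact n + ln (INR n + 1).
Proof.
unfold lnfact; rewrite fact_simpl, mult_INR, ln_mult, S_INR.
- ring.
- apply lt_0_INR; lia.
- apply fact_pos.
Qed.

Lemma is_Gamma_fact (n : nat) : is_Gamma (INR n + 1) (INR (fact n)).
Proof.
induction n as [|n IH].
- simpl; rewrite Rplus_0_l; exact is_Gamma_1.
- rewrite fact_simpl, mult_INR, S_INR; apply is_Gamma_succ; [|exact IH].
  generalize (pos_INR n); lra.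
Qed.

(** The rising factorial is stored as the exponential of a sum of logarithms, ready for the additive
    limits that follow. *)
Lemma is_Gamma_rising (x l : R) (n : nat) : 0 < x -> is_Gamma x l ->
  is_Gamma (INR n + x) (l * exp (psum (fun k => ln (INR k + x)) n)).
Proof.
intros Hx Hl; induction n as [|n IH].
- simpl; rewrite Rplus_0_l, exp_0, Rmult_1_r; exact Hl.
- assert (Hn := pos_INR n).
  cbn [psum]; rewrite exp_plus, exp_ln by lra.
  rewrite S_INR; replace (INR n + 1 + x) with (INR n + x + 1) by ring.
  replace (l * (exp (psum (fun k => ln (INR k + x)) n) * (INR n + x))) with
    ((INR n + x) * (l * exp (psum (fun k => ln (INR k + x)) n))) by ring.
  apply is_Gamma_succ; [lra | exact IH].
Qed.

(** Gauss's product by a squeeze in the style of Bohr and Mollerup: the shift by 3/4 from [n + 1/4]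
    to [n + 1] gives one side, the shift by 1/4 from [n] to [n + 1/4] the other. The two differ by
    [3/4 ln ((n + 1/4) / n) <= 3 / (16 n)]. *)
Lemma ln_Gamma_quarter_lim :
  is_lim_seq (fun n => lnfact n - 3 / 4 * ln (INR n) - psum (fun k => ln (INR k + 1 / 4)) n)
    (ln (Gamma (1 / 4))).
Proof.
destruct (is_Gamma_ex (1 / 4) ltac:(lra)) as [l Hl].
assert (E : Gamma (1 / 4) = l).
{ unfold Gamma; apply (is_RInt_gen_unique (V := R_CompleteNormedModule)); exact Hl. }
rewrite E; clear E.
assert (Hp : forall n, INR (fact n) <= Rpower (INR n + 1 / 4) (3 / 4) *
  (l * exp (psum (fun k => ln (INR k + 1 / 4)) n))).
{ intros n; apply (is_Gamma_shift_le (INR n + 1 / 4)).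
  - generalize (pos_INR n); lra.
  - lra.
  - apply is_Gamma_rising; [lra | exact Hl].
  - replace (INR n + 1 / 4 + 3 / 4) with (INR n + 1) by field; apply is_Gamma_fact. }
(* The case [n = 0] reads [1 <= (1/4)^(3/4) * l]. *)
assert (Hl0 : 0 < l).
{ specialize (Hp 0%nat); simpl in Hp; rewrite exp_0, Rmult_1_r in Hp.
  assert (0 < Rpower (0 + 1 / 4) (3 / 4)) by apply exp_pos; nra. }
set (L := fun n => psum (fun k => ln (INR k + 1 / 4)) n).
assert (Hlow : forall n, lnfact n - 3 / 4 * ln (INR n + 1 / 4) - L n <= ln l).
{ intros n; specialize (Hp n); fold (L n) in Hp.
  apply ln_le in Hp; [|apply fact_pos].
  rewrite !ln_mult in Hp; try apply exp_pos; try assumption.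
  - rewrite ln_exp in Hp; unfold Rpower in Hp; rewrite ln_exp in Hp; unfold lnfact; lra.
  - apply Rmult_lt_0_compat; [exact Hl0 | apply exp_pos]. }
assert (Hup : forall n, (1 <= n)%nat -> ln l <= lnfact n - 3 / 4 * ln (INR n) - L n).
{ intros n Hn; destruct n as [|n]; [lia|].
  assert (H := is_Gamma_shift_le (INR n + 1) (1 / 4) (INR (fact n)) (l * exp (L (S n)))).
  apply ln_le in H.
  - rewrite !ln_mult in H; try apply exp_pos; try assumption; try apply fact_pos.
    rewrite ln_exp in H; unfold Rpower in H; rewrite ln_exp in H.
    rewrite lnfact_S, S_INR; unfold lnfact; lra.
  - apply Rmult_lt_0_compat; [exact Hl0 | apply exp_pos].
  - generalize (pos_INR n); lra.
  - lra.
  - apply is_Gamma_fact.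
  - rewrite <- S_INR; apply is_Gamma_rising; [lra | exact Hl]. }
apply is_lim_seq_le_le_loc with (u := fun _ => ln l) (w := fun n => ln l + 3 / 16 / INR n).
- exists 1%nat; intros n Hn; split; [apply Hup; exact Hn|].
  fold (L n); specialize (Hlow n).
  assert (Hn0 : 0 < INR n) by (apply lt_0_INR; lia).
  assert (H := ln_le_sub_1 ((INR n + 1 / 4) / INR n) ltac:(apply Rdiv_lt_0_compat; lra)).
  rewrite ln_div in H by lra.
  replace ((INR n + 1 / 4) / INR n - 1) with (1 / 4 / INR n) in H by (field; lra).
  unfold Rdiv in *; lra.
- apply is_lim_seq_const.
- evar_last.
  + apply is_lim_seq_plus'; [apply is_lim_seq_const | apply is_lim_seq_div_INR].
  + f_equal; ring.
Qed.

(** * Wallis's integrals and the central binomial coefficient *)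

Definition wallis (n : nat) : R := RInt (fun t => sin t ^ n) 0 (PI / 2).

Lemma ex_RInt_sin_pow (n : nat) (a b : R) : ex_RInt (fun t => sin t ^ n) a b.
Proof.
apply (ex_RInt_continuous (V := R_CompleteNormedModule)); intros t _.
apply (ex_derive_continuous (V := R_NormedModule)); auto_derive; exact I.
Qed.

(** [sin^(n+1) cos] vanishes at both ends, so the integral of its derivative is 0. *)
Lemma wallis_rec (n : nat) : (INR n + 2) * wallis (S (S n)) = (INR n + 1) * wallis n.
Proof.
assert (H : is_RInt (fun t => (INR n + 1) * sin t ^ n -
  (INR n + 2) * sin t ^ (S (S n))) 0 (PI / 2)
  (sin (PI / 2) ^ S n * cos (PI / 2) - sin 0 ^ S n * cos 0)).
{ apply (is_RInt_derive (V := R_CompleteNormedModule) (fun t => sin t ^ S n * cos t)).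
  - intros t _; auto_derive; [exact I|].
    assert (E := sin2_cos2 t); unfold Rsqr in E.
    rewrite <- !tech_pow_Rmult; change (match n with O => 1 | S _ => INR n + 1 end)
      with (INR (S n)); rewrite S_INR.
    transitivity ((INR n + 1) * sin t ^ n * (cos t * cos t) - sin t * sin t * sin t ^ n);
      [simpl; ring|].
    replace (cos t * cos t) with (1 - sin t * sin t) by lra; ring.
  - intros t _; apply (ex_derive_continuous (V := R_NormedModule)); auto_derive;
    repeat split. }
rewrite cos_PI2, sin_0, pow_ne_zero, Rmult_0_r, Rmult_0_l, Rminus_0_r in H by lia.
assert (H2 := is_RInt_minus (V := R_NormedModule) _ _ _ _ _ _
  (is_RInt_scal (V := R_NormedModule) _ _ _ (INR n + 1) _ (RInt_correct (V :=
    R_CompleteNormedModule) _ _ _ (ex_RInt_sin_pow n 0 (PI / 2))))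
  (is_RInt_scal (V := R_NormedModule) _ _ _ (INR n + 2) _ (RInt_correct (V :=
    R_CompleteNormedModule) _ _ _ (ex_RInt_sin_pow (S (S n)) 0 (PI / 2))))).
assert (E1 := is_RInt_unique (V := R_CompleteNormedModule) _ _ _ _ H).
assert (E2 := is_RInt_unique (V := R_CompleteNormedModule) _ _ _ _ H2).
assert (E3 : (INR n + 1) * wallis n - (INR n + 2) * wallis (S (S n)) = 0).
{ rewrite <- E1; symmetry; exact E2. }
lra.
Qed.

Lemma wallis_decr (n : nat) : wallis (S n) <= wallis n.
Proof.
assert (HPI := PI_RGT_0).
apply RInt_le; [lra | apply ex_RInt_sin_pow | apply ex_RInt_sin_pow|].
intros t Ht; simpl.
assert (0 <= sin t) by (apply sin_ge_0; lra).
assert (sin t <= 1) by apply SIN_bound.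
assert (0 <= sin t ^ n) by (apply pow_le; assumption); nra.
Qed.

Lemma wallis_0 : wallis 0 = PI / 2.
Proof.
unfold wallis; simpl.
rewrite (RInt_const (V := R_CompleteNormedModule)); unfold scal; simpl; unfold mult; simpl;
  ring.
Qed.

Lemma wallis_1 : wallis 1 = 1.
Proof.
unfold wallis; apply is_RInt_unique.
evar_last.
- apply (is_RInt_derive (V := R_CompleteNormedModule) (fun t => - cos t)).
  + intros t _; auto_derive; [exact I | ring].
  + intros t _; apply (ex_derive_continuous (V := R_NormedModule)); auto_derive; exact I.
- rewrite cos_PI2, cos_0; unfold minus, plus, opp; simpl; ring.
Qed.

Lemma wallis_product (n : nat) : (INR n + 1) * wallis (S n) * wallis n = PI / 2.
Proof.
induction n as [|n IH].
- rewrite wallis_0, wallis_1; simpl; ring.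
- rewrite S_INR; replace (INR n + 1 + 1) with (INR n + 2) by ring.
  rewrite wallis_rec, <- IH; ring.
Qed.

Lemma wallis_even (n : nat) : wallis (2 * n) = PI / 2 * exp (lnfact (2 * n) - 2 * lnfact n -
  2 * INR n * ln 2).
Proof.
induction n as [|n IH].
- change (2 * 0)%nat with 0%nat; rewrite wallis_0; unfold lnfact; simpl; rewrite ln_1.
  replace (0 - 2 * 0 - 2 * 0 * ln 2) with 0 by ring; rewrite exp_0; ring.
- assert (Hn := pos_INR n).
  assert (R := wallis_rec (2 * n)); rewrite IH in R.
  replace (2 * S n)%nat with (S (S (2 * n))) by lia.
  rewrite !lnfact_S, !S_INR, mult_INR in *; simpl (INR 2) in *.
  apply (Rmult_eq_reg_l ((1 + 1) * INR n + 2)); [|lra].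
  rewrite R.
  replace (lnfact (2 * n) + ln ((1 + 1) * INR n + 1) + ln ((1 + 1) * INR n + 1 + 1) -
     2 * (lnfact n + ln (INR n + 1)) - 2 * (INR n + 1) * ln 2) with
   ((lnfact (2 * n) - 2 * lnfact n -
     2 * INR n * ln 2) + (ln ((1 + 1) * INR n + 1) + (- ln ((1 + 1) * INR n + 2)))).
  + rewrite !exp_plus, exp_Ropp, !exp_ln by lra; field; lra.
  + replace ((1 + 1) * INR n + 1 + 1) with (2 * (INR n + 1)) by ring.
    replace ((1 + 1) * INR n + 2) with (2 * (INR n + 1)) by ring.
    rewrite ln_mult by lra; ring.
Qed.

(** The logarithm of [binomial(2n, n) / 4^n ~ 1 / sqrt (PI n)]. By monotonicity, the constant
    product at the indices [2n] and [2n - 1] confines [wallis (2 * n) ^ 2] between [PI / (2 (2n+1))]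
    and [PI / (4n)]. *)
Lemma wallis_lim :
  is_lim_seq (fun n => lnfact (2 * n) - 2 * lnfact n - 2 * INR n * ln 2 + ln (INR n) / 2)
    (- ln PI / 2).
Proof.
assert (HPI := PI_RGT_0).
apply is_lim_seq_le_le_loc with
  (u := fun n => - ln PI / 2 - 1 / 4 / INR n) (w := fun _ => - ln PI / 2).
- exists 1%nat; intros n Hn.
  assert (Hn0 : 0 < INR n) by (apply lt_0_INR; lia).
  assert (E := wallis_even n); set (w := lnfact (2 * n) - 2 * lnfact n -
    2 * INR n * ln 2) in *.
  assert (Hw : 0 < wallis (2 * n)).
  { rewrite E; apply Rmult_lt_0_compat; [lra | apply exp_pos]. }
  assert (Elw : ln (wallis (2 * n)) = ln PI - ln 2 + w).
  { rewrite E, ln_mult, ln_div, ln_exp by (try apply exp_pos; lra); reflexivity. }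
  assert (P1 := wallis_product (2 * n)).
  assert (D1 := wallis_decr (2 * n)).
  assert (P0 := wallis_product (2 * n - 1)).
  assert (D0 := wallis_decr (2 * n - 1)).
  rewrite minus_INR in P0 by lia.
  replace (S (2 * n - 1)) with (2 * n)%nat in * by lia.
  rewrite mult_INR in *; simpl (INR 2) in *; simpl (INR 1) in *.
  assert (Hl : ln (wallis (2 * n) * wallis (2 * n)) = 2 * (ln PI - ln 2 + w)).
  { rewrite ln_mult, Elw by exact Hw; ring. }
  assert (U : wallis (2 * n) * wallis (2 * n) <= PI / (4 * INR n)).
  { apply (Rmult_le_reg_l (2 * INR n)); [lra|].
    replace (2 * INR n * (PI / (4 * INR n))) with (PI / 2) by (field; lra).
    rewrite <- P0; replace (((1 + 1) * INR n - 1 + 1) * wallis (2 * n) * wallis (2 * n -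
      1)) with
      (2 * INR n * (wallis (2 * n) * wallis (2 * n - 1))) by ring.
    apply Rmult_le_compat_l; [lra|]; apply Rmult_le_compat_l; lra. }
  assert (V : PI / (2 * (2 * INR n + 1)) <= wallis (2 * n) * wallis (2 * n)).
  { apply (Rmult_le_reg_l (2 * INR n + 1)); [lra|].
    replace ((2 * INR n + 1) * (PI / (2 * (2 * INR n + 1)))) with (PI / 2) by (field; lra).
    rewrite <- P1; replace (((1 + 1) * INR n + 1) * wallis (S (2 * n)) * wallis (2 * n)) with
      ((2 * INR n + 1) * (wallis (S (2 * n)) * wallis (2 * n))) by ring.
    apply Rmult_le_compat_l; [lra|]; apply Rmult_le_compat_r; lra. }
  apply ln_le in U; [|apply Rmult_lt_0_compat; exact Hw].
  apply ln_le in V; [|apply Rdiv_lt_0_compat; lra].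
  rewrite Hl, ln_div, ln_mult in U by lra.
  rewrite Hl, ln_div, ln_mult in V by lra.
  assert (E4 : ln 4 = 2 * ln 2) by (replace 4 with (2 * 2) by ring; rewrite ln_mult by lra;
    ring).
  assert (Hs : ln (2 * INR n + 1) <= ln 2 + ln (INR n) + 1 / 2 / INR n).
  { assert (H := ln_le_sub_1 ((2 * INR n + 1) / (2 * INR n)) ltac:(apply Rdiv_lt_0_compat;
    lra)).
    rewrite ln_div, ln_mult in H by lra.
    replace ((2 * INR n + 1) / (2 * INR n) - 1) with (1 / 2 / INR n) in H by (field; lra);
      lra. }
  unfold Rdiv in *; lra.
- evar_last.
  + apply is_lim_seq_minus'; [apply is_lim_seq_const | apply is_lim_seq_div_INR].
  + f_equal; ring.
- apply is_lim_seq_const.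
Qed.

(** The odd factors of [(4K)!] are what remains after its even factors [2^(2K) (2K)!] are divided
    out. *)
Lemma odd_product (K : nat) :
  psum (fun k => ln (4 * INR k + 1) + ln (4 * INR k + 3)) K =
  lnfact (4 * K) - lnfact (2 * K) - 2 * INR K * ln 2.
Proof.
induction K as [|K IH].
- unfold lnfact; simpl; rewrite ln_1; ring.
- assert (HK := pos_INR K).
  cbn [psum]; rewrite IH.
  replace (4 * S K)%nat with (S (S (S (S (4 * K))))) by lia.
  replace (2 * S K)%nat with (S (S (2 * K))) by lia.
  rewrite !lnfact_S, !S_INR, !mult_INR; simpl (INR 4); simpl (INR 2).
  replace ((1 + 1 + 1 + 1) * INR K + 1 + 1) with (2 * (2 * INR K + 1)) by ring.
  replace (2 * (2 * INR K + 1) + 1 + 1) with (2 * ((1 + 1) * INR K + 1 + 1)) by ring.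
  replace (2 * (2 * INR K + 1) + 1) with (4 * INR K + 3) by ring.
  replace ((1 + 1 + 1 + 1) * INR K + 1) with (4 * INR K + 1) by ring.
  replace ((1 + 1) * INR K + 1) with (2 * INR K + 1) by ring.
  rewrite !(ln_mult 2) by lra; ring.
Qed.

(** The quotient is written as [(4k+1)(4k+3) / (4k+1)^2]. Wallis at [2K] plus Wallis at [K] leaves
    [(4K)! / ((2K)! K!^2)], and twice Gauss's limit cancels [K!^2]. *)
Lemma log_quotient_Gamma :
  is_lim_seq (fun K => psum (fun k => ln ((4 * INR k + 3) / (4 * INR k + 1))) K -
    ln (INR K) / 2)
    (2 * ln (Gamma (1 / 4)) - ln PI - ln 2 / 2).
Proof.
assert (E : forall K, psum (fun k => ln ((4 * INR k + 3) / (4 * INR k + 1))) K =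
  lnfact (4 * K) - lnfact (2 * K) - 2 * INR K * ln 2
  - 2 * (psum (fun k => ln (INR k + 1 / 4)) K + 2 * INR K * ln 2)).
{ intros K; rewrite <- odd_product.
  induction K as [|K IH]; [simpl; ring|].
  cbn [psum]; rewrite IH, S_INR.
  assert (HK := pos_INR K).
  rewrite ln_div by lra.
  replace (4 * INR K + 1) with (2 * (2 * (INR K + 1 / 4))) by field.
  rewrite !(ln_mult 2) by lra; ring. }
assert (W2 := even_subseq_lim _ _ wallis_lim).
assert (G2 := is_lim_seq_mult' _ _ _ _ (is_lim_seq_const 2) ln_Gamma_quarter_lim).
assert (L := is_lim_seq_minus' _ _ _ _
  (is_lim_seq_plus' _ _ _ _ (is_lim_seq_plus' _ _ _ _ W2 wallis_lim) G2)
  (is_lim_seq_const (ln 2 / 2))).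
replace (2 * ln (Gamma (1 / 4)) - ln PI - ln 2 / 2) with
  (- ln PI / 2 + - ln PI / 2 + 2 * ln (Gamma (1 / 4)) - ln 2 / 2) by field.
apply is_lim_seq_ext_loc with (2 := L).
exists 1%nat; intros K HK.
assert (HK0 : 0 < INR K) by (apply lt_0_INR; lia).
rewrite E; replace (2 * (2 * K))%nat with (4 * K)%nat by lia.
rewrite mult_INR; simpl (INR 2); replace (1 + 1) with 2 by ring.
rewrite (ln_mult 2) by lra; field.
Qed.

(** * Laurent coefficients at the pole *)

Lemma is_series_Re (a : nat -> C) (l : C) :
  is_series (K := C_AbsRing) (V := C_NormedModule) a l ->
  is_series (fun n => Re (a n)) (Re l).
Proof.
intros H.
assert (E : forall N, sum_n (fun n => Re (a n)) N = Re (sum_n a N)).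
{ induction N as [|N IH]; [rewrite !sum_O; reflexivity|].
  rewrite !sum_Sn, IH; reflexivity. }
assert (HL : filterlim (fun N => Re (sum_n a N)) Hierarchy.eventually (locally (Re l))).
{ eapply filterlim_comp; [exact H|].
  destruct l as [x y]; exact (continuous_fst (U := R_UniformSpace)
    (V := R_UniformSpace) x y). }
apply (filterlim_ext (fun N => Re (sum_n a N))); [intros; symmetry; apply E | exact HL].
Qed.

Lemma is_hurwitz_zeta_real (u : R) (Z : C -> C) (e : R) :
  is_hurwitz_zeta u Z -> 0 < u -> 0 < e ->
  is_lim_seq (psum (fun n => Rpower (INR n + u) (- (1 + e)))) (Re (Z (RtoC (1 + e)))).
Proof.
intros [_ HZ] Hu He.
specialize (HZ (RtoC (1 + e)) ltac:(simpl; lra)).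
apply is_series_Re, is_series_psum in HZ.
apply is_lim_seq_ext with (2 := HZ); intros N; apply psum_ext; intros n.
unfold rpowC, Rpower; simpl.
rewrite Ropp_0, Rmult_0_l, cos_0; ring.
Qed.

(** [P] is the real power series of the regular part, so it has a value and a derivative at 0
    although the Laurent hypothesis concerns a punctured disc. *)
Lemma is_stieltjes_real (Z : C -> C) (g : nat -> R) :
  is_stieltjes Z g ->
  exists (r : R) (P : R -> R), 0 < r /\
    (forall e, 0 < e < r -> Re (Z (RtoC (1 + e))) = / e + P e) /\
    is_derive P 0 (- g 1%nat).
Proof.
intros [r [Hr H]].
set (a := fun p : nat => (-1) ^ p / INR (fact p) * g p).
assert (Ha : forall e, 0 < e < r -> is_pseries a e (Re (Z (RtoC (1 + e))) - / e)).
{ intros e He.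
  assert (Es : (RtoC (1 + e) - 1)%C = RtoC e).
  { rewrite <- RtoC_minus; f_equal; ring. }
  specialize (H (RtoC (1 + e))); rewrite Es, Cmod_R, Rabs_pos_eq in H by lra.
  specialize (H He); apply is_series_Re in H.
  assert (Epow : forall k, pow_n (K := C_AbsRing) (RtoC e) k = RtoC (e ^ k)).
  { induction k as [|k IH]; [reflexivity|].
    simpl pow_n; rewrite IH; simpl; rewrite RtoC_mult; reflexivity. }
  assert (El : Re (Z (RtoC (1 + e)) - 1 / RtoC e)%C = Re (Z (RtoC (1 + e))) - / e).
  { destruct (Z (RtoC (1 + e))) as [x y]; unfold Cdiv, Cminus, Cplus, Copp, Cmult, Cinv, RtoC;
    simpl.
    field; lra. }
  rewrite El in H; unfold is_pseries.
  apply is_series_ext with (2 := H); intros k.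
  rewrite Epow.
  unfold a, scal; simpl; unfold mult; simpl.
  change (pow_n e k) with (e ^ k); ring. }
(* Convergence at [r/2] makes the terms there tend to 0, which excludes a radius below [r/4]. *)
assert (Hcv : Rbar_lt (Rabs 0) (CV_radius a)).
{ rewrite Rabs_R0.
  assert (Hex : ex_pseries a (r / 2)) by (eexists; apply Ha; lra).
  destruct (Rbar_lt_le_dec (CV_radius a) (Rabs (r / 4))) as [Hlt | Hle].
  - exfalso; apply (CV_disk_outside a (r / 2)).
    + apply Rbar_lt_trans with (1 := Hlt); simpl; rewrite !Rabs_pos_eq by lra; lra.
    + apply ex_series_lim_0 in Hex.
      apply is_lim_seq_ext with (2 := Hex); intros n.
      unfold scal; simpl; unfold mult; simpl.
      change (pow_n (r / 2) n) with ((r / 2) ^ n); ring.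
  - apply Rbar_lt_le_trans with (2 := Hle); simpl; rewrite Rabs_pos_eq; lra. }
exists r, (PSeries a); split; [exact Hr|]; split.
- intros e He; rewrite (is_pseries_unique _ _ _ (Ha e He)); lra.
- evar_last; [apply is_derive_PSeries; exact Hcv|].
  rewrite PSeries_0; unfold PS_derive, a; simpl; field.
Qed.

Local Notation right_lim f l := (filterlim f (at_right 0) (locally l)).

Lemma right_lim_ext (f g : R -> R) (r l : R) : 0 < r ->
  (forall e, 0 < e < r -> f e = g e) -> right_lim f l -> right_lim g l.
Proof.
intros Hr H; apply filterlim_ext_loc.
apply filter_imp with (2 := at_right_0_lt r Hr); exact H.
Qed.

Lemma right_lim_eq (f : R -> R) (l m : R) : l = m -> right_lim f l -> right_lim f m.
Proof. intros ->; auto. Qed.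

Lemma right_lim_continuous (f : R -> R) : continuous f 0 -> right_lim f (f 0).
Proof.
intros H; eapply filterlim_filter_le_1; [apply filter_le_within | exact H].
Qed.

Lemma right_lim_quotient (f : R -> R) (l : R) :
  is_derive f 0 l -> right_lim (fun e => (f e - f 0) / e) l.
Proof.
intros H; apply is_derive_Reals in H.
apply filterlim_locally; intros [eps Heps].
destruct (H eps Heps) as [[d Hd] Hl]; simpl in Hl.
apply filter_imp with (2 := at_right_0_lt d Hd); intros e He.
specialize (Hl e ltac:(lra)); rewrite Rabs_pos_eq in Hl by lra.
specialize (Hl ltac:(lra)); rewrite Rplus_0_l in Hl; exact Hl.
Qed.

Lemma right_lim_unique (f : R -> R) (l m : R) : right_lim f l -> right_lim f m -> l = m.
Proof.
intros H1 H2.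
exact (filterlim_locally_unique (K := R_AbsRing) (V := R_NormedModule) f l m H1 H2).
Qed.

Lemma Rpower_neg_decr (x y a : R) : 0 < x <= y -> 0 <= a -> Rpower y (- a) <= Rpower x (- a).
Proof.
intros Hx Ha; apply exp_le_mono.
assert (ln x <= ln y) by (apply ln_le; lra); nra.
Qed.

(** The middle term is the integral of [t^-(1+e)] over [[x, x+1]]; the outer terms are the values of
    the integrand at the ends. *)
Lemma Rpower_neg_increment (x e : R) : 0 < x -> 0 < e ->
  Rpower (x + 1) (- (1 + e)) <= (Rpower x (- e) - Rpower (x + 1)
    (- e)) / e <= Rpower x (- (1 + e)).
Proof.
intros Hx He.
set (f := fun t => - (Rpower t (- e) / e)).
assert (Hd : forall t, x <= t <= x + 1 -> is_derive f t (Rpower t (- (1 + e)))).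
{ intros t Ht; unfold f; evar_last.
  - apply (is_derive_opp (V := R_NormedModule)).
    apply (is_derive_scal_l (V := R_NormedModule)), is_derive_Rpower; lra.
  - unfold opp, scal; simpl; unfold mult; simpl.
    replace (- e - 1) with (- (1 + e)) by ring; field; lra. }
assert (Hc : forall c t, is_derive (fun t => c * t) t c).
{ intros c t; auto_derive; [exact I | ring]. }
replace ((Rpower x (- e) - Rpower (x + 1) (- e)) / e) with (f (x + 1) - f x) by (unfold f;
  field; lra).
split.
- set (c := Rpower (x + 1) (- (1 + e))).
  replace c with (c * (x + 1) - c * x) by ring.
  apply (is_derive_le (fun t => c * t) f (fun _ => c) (fun t => Rpower t (- (1 + e)))); auto;
    [lra|].
  intros t Ht; apply Rpower_neg_decr; lra.
- set (c := Rpower x (- (1 + e))).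
  replace c with (c * (x + 1) - c * x) by ring.
  apply (is_derive_le f (fun t => c * t) (fun t => Rpower t (- (1 + e))) (fun _ => c)); auto;
    [lra|].
  intros t Ht; apply Rpower_neg_decr; lra.
Qed.

Lemma Rpower_is_derive_exponent (x y : R) :
  is_derive (fun e => Rpower x (y - e)) 0 (- (ln x * Rpower x y)).
Proof.
unfold Rpower; auto_derive; [exact I|].
replace (y + - 0) with y by ring; ring.
Qed.

Lemma Rpower_m1 (x : R) : 0 < x -> Rpower x (-1) = / x.
Proof.
intros Hx; replace (-1) with (Ropp 1) by ring.
rewrite Rpower_Ropp, Rpower_1 by exact Hx; reflexivity.
Qed.

Lemma psum_tail_telescope (d f : nat -> R) (N M : nat) :
  (N <= M)%nat -> (forall n, (N <= n)%nat -> 0 <= d n <= f n - f (S n)) ->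
  0 <= psum d M - psum d N <= f N - f M.
Proof.
intros HNM Hd; induction HNM as [|M HNM IH].
- lra.
- cbn [psum]; specialize (Hd M HNM); lra.
Qed.

(** [1/e] is the integral of [t^-(1+e)] over [[1, oo)]. Cut into unit intervals and subtracted
    termwise, it leaves nonnegative terms with telescoping tails; the termwise limits
    [1/(n+1) - ln ((n+2)/(n+1))] sum to Euler's constant. *)
Lemma zeta_minus_pole_lim (z : R -> R) :
  (forall e, 0 < e -> is_lim_seq (psum (fun n => Rpower (INR n + 1) (- (1 + e)))) (z e)) ->
  right_lim (fun e => z e - / e) euler_gamma.
Proof.
intros Hz.
set (d := fun e n => Rpower (INR n + 1) (- (1 + e)) -
  (Rpower (INR n + 1) (- e) - Rpower (INR n + 2) (- e)) / e).
set (d0 := fun n => / (INR n + 1) - (ln (INR n + 2) - ln (INR n + 1))).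
destruct (tannery d d0 (fun e => z e - / e) (fun N => 1 / INR N)) as [D [HD1 HD2]].
- intros e N M He [HN HNM].
  assert (HN0 : 0 < INR N) by (apply lt_0_INR; lia).
  assert (H := psum_tail_telescope (d e) (fun n => Rpower (INR n + 1) (- (1 + e))) N M HNM).
  assert (HM : 0 < Rpower (INR M + 1) (- (1 + e))) by apply exp_pos.
  assert (HN1 : Rpower (INR N + 1) (- (1 + e)) <= 1 / INR N).
  { apply Rle_trans with (Rpower (INR N + 1) (-1)).
    - apply Rle_Rpower; lra.
    - rewrite Rpower_m1 by lra; unfold Rdiv; rewrite Rmult_1_l.
      apply Rinv_le_contravar; lra. }
  apply Rabs_le; enough (0 <= psum (d e) M - psum (d e) N <=
    Rpower (INR N + 1) (- (1 + e)) - Rpower (INR M + 1) (- (1 + e))) by lra.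
  apply H; intros n _; unfold d; rewrite S_INR.
  assert (Hn := pos_INR n).
  replace (INR n + 2) with (INR n + 1 + 1) by ring.
  generalize (Rpower_neg_increment (INR n + 1) e ltac:(lra) He); lra.
- intros e He.
  assert (E : forall N, psum (d e) N = psum (fun n => Rpower (INR n + 1) (- (1 + e))) N -
     (1 - Rpower (INR N + 1) (- e)) / e).
  { intros N; unfold d; rewrite psum_minus; f_equal.
    induction N as [|N IH].
    - simpl; rewrite Rplus_0_l; unfold Rpower; rewrite ln_1, Rmult_0_r, exp_0; field; lra.
    - cbn [psum]; rewrite IH, S_INR; replace (INR N + 1 + 1) with (INR N + 2) by ring; field;
      lra. }
  apply is_lim_seq_ext with (1 := fun N => eq_sym (E N)).
  replace (/ e) with ((1 - 0) * / e) by ring.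
  apply is_lim_seq_minus'; [apply Hz; exact He|].
  apply is_lim_seq_mult'; [|apply is_lim_seq_const].
  apply is_lim_seq_minus'; [apply is_lim_seq_const|].
  apply is_lim_seq_spec; intros [eps Heps]; simpl.
  (* [N0] is chosen beyond [eps^(-1/e)]. *)
  destruct (archimed_cor1 (exp (ln eps / e)) (exp_pos _)) as [N0 [HN0 HN0p]].
  exists N0; intros N HN; rewrite Rminus_0_r, Rabs_pos_eq by (left; apply exp_pos).
  assert (HN1 : 0 < INR N0) by (apply lt_0_INR; exact HN0p).
  assert (HN2 : INR N0 <= INR N) by (apply le_INR; exact HN).
  apply ln_increasing in HN0; [|apply Rinv_0_lt_compat; exact HN1].
  rewrite ln_exp, ln_Rinv in HN0 by exact HN1.
  assert (HN3 : ln (INR N0) <= ln (INR N + 1)) by (apply ln_le; lra).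
  unfold Rpower; rewrite <- (exp_ln eps) by exact Heps.
  apply exp_increasing.
  apply (Rmult_lt_compat_l e) in HN0; [|exact He].
  replace (e * (ln eps / e)) with (ln eps) in HN0 by (field; lra); nra.
- intros n; unfold d, d0.
  assert (Hn := pos_INR n).
  assert (HR : forall x, 0 < x -> Rpower x (0 - 0) = 1).
  { intros x Hx; rewrite Rminus_diag; apply Rpower_O; exact Hx. }
  assert (L1 : right_lim (fun e => Rpower (INR n + 1) (- (1 + e))) (/ (INR n + 1))).
  { replace (/ (INR n + 1)) with (Rpower (INR n + 1) (- (1 + 0)))
      by (rewrite Rplus_0_r, Rpower_Ropp, Rpower_1 by lra; reflexivity).
    apply (right_lim_continuous (fun e => Rpower (INR n + 1) (- (1 + e)))).
    apply (ex_derive_continuous (V := R_NormedModule)); unfold Rpower; auto_derive; exact I. }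
  assert (L2 := right_lim_quotient _ _ (Rpower_is_derive_exponent (INR n + 1) 0)).
  assert (L3 := right_lim_quotient _ _ (Rpower_is_derive_exponent (INR n + 2) 0)).
  assert (L := filterlim_Rminus _ _ _ _ L1 (filterlim_Rminus _ _ _ _ L2 L3)).
  replace (/ (INR n + 1) - (ln (INR n + 2) - ln (INR n + 1))) with
   (/ (INR n + 1) - (- (ln (INR n + 1) * Rpower (INR n + 1) 0) - -
     (ln (INR n + 2) * Rpower (INR n + 2) 0)))
   by (rewrite !Rpower_O by lra; ring).
  apply right_lim_ext with (3 := L) (r := 1); [lra|].
  intros e He; cbv beta; rewrite !HR, !Rminus_0_l by lra; field; lra.
- apply is_lim_seq_div_INR.
- enough (D = euler_gamma) as <- by exact HD2.
  assert (E : forall N, psum d0 N = harm N - ln (INR N + 1)).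
  { intros N; unfold d0, harm; induction N as [|N IH].
    - simpl; rewrite Rplus_0_l, ln_1; ring.
    - cbn [psum]; rewrite IH, S_INR; replace (INR N + 1 + 1) with (INR N + 2) by ring; ring. }
  assert (HL : is_lim_seq (psum d0) (euler_gamma - 0)).
  { apply is_lim_seq_ext with (fun N => (harm N - ln (INR N)) - (ln (INR N + 1) - ln (INR N))).
    - intros N; rewrite E; ring.
    - apply is_lim_seq_minus'; [exact (proj1 euler_gamma_spec)|].
      apply is_lim_seq_le_le_loc with (u := fun _ => 0) (w := fun N => 1 / INR N).
      + exists 1%nat; intros N HN; assert (HN0 : 0 < INR N) by (apply lt_0_INR; lia).
        assert (H := ln_succ_bounds (INR N) HN0).
        assert (0 < / (INR N + 1)) by (apply Rinv_0_lt_compat; lra).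
        unfold Rdiv; lra.
      + apply is_lim_seq_const.
      + apply is_lim_seq_div_INR. }
  apply is_lim_seq_unique in HD1; apply is_lim_seq_unique in HL.
  rewrite HD1 in HL; injection HL; intros ->; ring.
Qed.

(** * The derivative of beta at 1 *)

(** Minus the difference quotient of [x^-s] between [s = 1] and [s = 1 + e], so that its limit is
    [+ ln x / x]. *)
Definition beta_quotient (e x : R) : R := (/ x - Rpower x (- (1 + e))) / e.

Lemma beta_quotient_exp (e x : R) : 0 < x ->
  beta_quotient e x = / x * (1 - exp (- e * ln x)) / e.
Proof.
intros Hx; unfold beta_quotient.
replace (- (1 + e)) with (-1 + - e) by ring.
rewrite Rpower_plus, Rpower_m1 by exact Hx.
unfold Rpower, Rdiv; ring.
Qed.

Lemma beta_quotient_bounds (e x : R) : 0 < e -> 1 <= x ->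
  0 <= beta_quotient e x <= ln x / x.
Proof.
intros He Hx; rewrite beta_quotient_exp by lra.
assert (Hl : 0 <= ln x) by (rewrite <- ln_1; apply ln_le; lra).
assert (H1 := exp_ineq1_le (- e * ln x)).
assert (H2 : exp (- e * ln x) <= 1) by (rewrite <- exp_0; apply exp_le_mono; nra).
assert (Hxi : 0 < / x) by (apply Rinv_0_lt_compat; lra).
assert (Hei : 0 < / e) by (apply Rinv_0_lt_compat; lra).
split.
- apply Rmult_le_pos; [apply Rmult_le_pos; lra | lra].
- apply Rle_trans with (/ x * (e * ln x) / e).
  + apply Rmult_le_compat_r; [lra|]; apply Rmult_le_compat_l; lra.
  + right; field; lra.
Qed.

(** The threshold 3 exceeds [exp 1] and does not depend on [e]: for [x >= 3],
    [x^e >= exp e >= 1 + e], which fixes the sign of the derivative. *)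
Lemma beta_quotient_decr (e x y : R) : 0 < e -> 3 <= x <= y ->
  beta_quotient e y <= beta_quotient e x.
Proof.
intros He Hx.
assert (H : - beta_quotient e x <= - beta_quotient e y); [|lra].
apply (is_derive_monotone (fun x => - beta_quotient e x)
  (fun x => / x ^ 2 * (1 - (1 + e) * exp (- e * ln x)) / e)); [lra| |].
- intros t Ht.
  apply (is_derive_ext_loc (fun x => - (/ x * (1 - exp (- e * ln x)) / e))).
  + exists (mkposreal t ltac:(lra)); intros s Hs.
    unfold ball in Hs; simpl in Hs; unfold AbsRing_ball, abs, minus, plus, opp in Hs;
      simpl in Hs.
    apply Rabs_def2 in Hs; rewrite beta_quotient_exp by lra; reflexivity.
  + auto_derive; [split; [lra | split; [lra | exact I]] | field; lra].
- intros t Ht.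
  assert (Hl : 1 <= ln t).
  { rewrite <- (ln_exp 1); apply ln_le; [apply exp_pos|]; generalize exp_le_3; lra. }
  assert (H1 := exp_ineq1_le e).
  assert (H2 : exp e <= exp (e * ln t)) by (apply exp_le_mono; nra).
  assert (H3 : exp (e * ln t) * exp (- e * ln t) = 1).
  { rewrite <- exp_plus, <- exp_0; f_equal; ring. }
  assert (H4 := exp_pos (- e * ln t)).
  assert (H5 : (1 + e) * exp (- e * ln t) <= 1) by (rewrite <- H3; apply Rmult_le_compat_r;
    lra).
  apply Rmult_le_pos; [apply Rmult_le_pos|].
  + left; apply Rinv_0_lt_compat, pow_lt; lra.
  + lra.
  + left; apply Rinv_0_lt_compat; lra.
Qed.

Lemma beta_quotient_lim (x : R) : 0 < x -> right_lim (fun e => beta_quotient e x) (ln x / x).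
Proof.
intros Hx.
assert (L := right_lim_quotient _ _ (Rpower_is_derive_exponent x (-1))).
assert (L' := filterlim_Rmult _ _ _ _ L (filterlim_const (-1))).
replace (ln x / x) with (- (ln x * Rpower x (-1)) * -1)
  by (rewrite Rpower_m1 by exact Hx; field; lra).
apply right_lim_ext with (3 := L') (r := 1); [lra|].
intros e He; unfold beta_quotient; rewrite Rminus_0_r.
replace (- (1 + e)) with (-1 - e) by ring.
rewrite Rpower_m1 by exact Hx; field; lra.
Qed.

Lemma psum_alt_pairs (g : R -> R) (M : nat) :
  psum (fun n => alt n * g (odd n)) (2 * M) =
  psum (fun k => g (4 * INR k + 1) - g (4 * INR k + 3)) M.
Proof.
rewrite psum_double; apply psum_ext; intros k.
assert (E1 : odd (2 * k) = 4 * INR k + 1) by (unfold odd; rewrite mult_INR; simpl; ring).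
assert (E2 : odd (2 * k + 1) = 4 * INR k + 3) by (unfold odd; rewrite plus_INR, mult_INR;
  simpl; ring).
rewrite E1, E2, alt_even.
unfold alt; rewrite pow_add, pow_1_even; ring.
Qed.

(** [B e] is beta at [1 + e] and [PI / 4] is beta at 1. Pairing consecutive terms bounds each tail,
    as for an alternating series, by its first term, which is at most [ln (4N+1) / (4N+1)] uniformly
    in [e]. *)
Lemma beta_derivative_lim (B : R -> R) :
  (forall e, 0 < e -> is_lim_seq (psum (fun k => Rpower (4 * INR k + 1) (- (1 + e)) -
     Rpower (4 * INR k + 3) (- (1 + e)))) (B e)) ->
  exists S : R, is_lim_seq (fun M => psum (fun n => alt n / odd n * ln (odd n)) (2 * M)) S /\
    right_lim (fun e => (PI / 4 - B e) / e) S.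
Proof.
intros HB.
destruct (tannery (fun e k => beta_quotient e (4 * INR k + 1) -
  beta_quotient e (4 * INR k + 3))
  (fun k => ln (4 * INR k + 1) / (4 * INR k + 1) - ln (4 * INR k + 3) / (4 * INR k + 3))
  (fun e => (PI / 4 - B e) / e) (fun N => ln (4 * INR N + 1) / (4 * INR N + 1))) as [S [HS1
    HS2]].
- intros e N M He [HN HNM].
  assert (H := psum_tail_telescope (fun k => beta_quotient e (4 * INR k + 1) -
    beta_quotient e (4 * INR k + 3))
    (fun k => beta_quotient e (4 * INR k + 1)) N M HNM).
  assert (HN1 := pos_INR N); assert (HM1 := pos_INR M).
  assert (H1 := beta_quotient_bounds e (4 * INR N + 1) He ltac:(lra)).
  assert (H2 := beta_quotient_bounds e (4 * INR M + 1) He ltac:(lra)).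
  cbv beta in H |- *; apply Rabs_le.
  destruct H as [H3 H4]; [|lra].
  intros n Hn.
  (* From [n = 1] on all arguments are at least 5. The pair [n = 0] starts at [x = 1], outside the
     range of monotonicity, and stays out of the tails. *)
  assert (Hn1 : 1 <= INR n) by (apply (le_INR 1); lia).
  rewrite S_INR.
  generalize (beta_quotient_decr e (4 * INR n + 1) (4 * INR n + 3) He ltac:(lra)).
  generalize (beta_quotient_decr e (4 * INR n + 3) (4 * (INR n + 1) + 1) He ltac:(lra)).
  lra.
- intros e He.
  assert (L := is_lim_seq_mult' _ _ _ _ (is_lim_seq_minus' _ _ _ _
    (even_subseq_lim _ _ leibniz_lim) (HB e He)) (is_lim_seq_const (/ e))).
  apply is_lim_seq_ext with (2 := L); intros M.
  unfold leibniz, Rdiv.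
  rewrite (psum_alt_pairs Rinv), <- psum_minus, Rmult_comm, <- psum_scal.
  apply psum_ext; intros k; assert (Hk := pos_INR k); unfold beta_quotient; field; lra.
- intros k; assert (Hk := pos_INR k).
  apply filterlim_Rminus; apply beta_quotient_lim; lra.
- assert (HL : is_lim_seq (fun N => 4 * INR N + 1) p_infty).
  { apply is_lim_seq_le_p_loc with INR; [|apply is_lim_seq_INR].
    exists 0%nat; intros n _; generalize (pos_INR n); lra. }
  apply (is_lim_comp_seq (fun y => ln y / y) _ p_infty 0 is_lim_div_ln_p); [|exact HL].
  exists 0%nat; intros; discriminate.
- exists S; split; [|exact HS2].
  apply is_lim_seq_ext with (2 := HS1); intros M.
  rewrite <- (psum_alt_pairs (fun x => ln x / x)).
  apply psum_ext; intros n; unfold Rdiv; ring.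
Qed.

Lemma Rpower_base_mult (c x y : R) : 0 < c -> 0 < x -> Rpower (c * x) y = Rpower c y * Rpower
  x y.
Proof. intros Hc Hx; rewrite Rpower_mult_distr by assumption; reflexivity. Qed.

(* The even integers contribute [2^-s zeta(s)] to [zeta(s)], and the integers
   [1 mod 4] contribute [4^-s zeta(s, 1/4)]. *)
Lemma beta_hurwitz (q z s : R) :
  is_lim_seq (psum (fun n => Rpower (INR n + 1 / 4) (- s))) q ->
  is_lim_seq (psum (fun n => Rpower (INR n + 1) (- s))) z ->
  is_lim_seq (psum (fun k => Rpower (4 * INR k + 1) (- s) - Rpower (4 * INR k + 3) (- s)))
    (2 * Rpower 4 (- s) * q - (1 - Rpower 2 (- s)) * z).
Proof.
intros Hq Hz.
assert (Hz2 := even_subseq_lim _ _ Hz).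
assert (Hz4 := even_subseq_lim _ _ Hz2).
assert (L := is_lim_seq_minus' _ _ _ _ (is_lim_seq_mult' _ _ _ _ (is_lim_seq_const (2 * Rpower
  4 (- s))) Hq)
  (is_lim_seq_minus' _ _ _ _ Hz4 (is_lim_seq_mult' _ _ _ _ (is_lim_seq_const (Rpower 2 (- s)))
    Hz2))).
replace (2 * Rpower 4 (- s) * q - (1 - Rpower 2 (- s)) * z) with
  (2 * Rpower 4 (- s) * q - (z - Rpower 2 (- s) * z)) by ring.
apply is_lim_seq_ext with (2 := L); intros M; cbv beta.
(* The integers up to [4M], less [2^-s] times those up to [2M], leave the odd ones. Twice the class
   1 mod 4 minus these is class 1 minus class 3. *)
rewrite (psum_double _ (2 * M)), <- psum_scal, <- psum_scal, <- psum_minus, psum_double,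
  <- psum_minus.
apply psum_ext; intros k; assert (Hk := pos_INR k).
rewrite !plus_INR, !mult_INR, plus_INR, mult_INR; simpl (INR 2); simpl (INR 1).
replace (4 * INR k + 1) with (4 * (INR k + 1 / 4)) at 1 by field.
rewrite (Rpower_base_mult 4) by lra.
rewrite <- !Rpower_base_mult by lra.
replace ((1 + 1) * ((1 + 1) * INR k) + 1) with (4 * (INR k + 1 / 4)) by field.
replace ((1 + 1) * ((1 + 1) * INR k + 1) + 1) with (4 * INR k + 3) by ring.
replace (2 * ((1 + 1) * INR k + 1)) with ((1 + 1) * ((1 + 1) * INR k) + 1 + 1) by ring.
replace (2 * ((1 + 1) * INR k + 1 + 1)) with ((1 + 1) * ((1 + 1) * INR k + 1) + 1 + 1) by ring.
rewrite (Rpower_base_mult 4) by lra.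
replace ((1 + 1) * ((1 + 1) * INR k) + 1 + 1) with (4 * (INR k + 1 / 4) + 1) by field.
replace ((1 + 1) * ((1 + 1) * INR k + 1) + 1 + 1) with (4 * INR k + 3 + 1) by ring.
ring.
Qed.

(** The bounds [1 <= exp <= 3] on [[0, 1]], integrated repeatedly; the crude 3 turns the remainder
    [y^3/6] into [y^3/2]. *)
Lemma exp_taylor_2 (y : R) : 0 <= y <= 1 -> 0 <= exp y - 1 - y - y ^ 2 / 2 <= y ^ 3 / 2.
Proof.
intros Hy.
assert (He : forall t, 0 <= t <= 1 -> 1 <= exp t <= 3).
{ intros t Ht; split.
  - rewrite <- exp_0; apply exp_le_mono; lra.
  - apply Rle_trans with (2 := exp_le_3); apply exp_le_mono; lra. }
assert (D0 : forall t, is_derive exp t (exp t)) by apply is_derive_exp.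
assert (B1 : forall t, 0 <= t <= 1 -> t <= exp t - 1 <= 3 * t).
{ intros t Ht; split.
  - replace t with (t - 0) at 1 by ring; rewrite <- exp_0.
    apply (is_derive_le (fun t => t) exp (fun _ => 1) exp); [lra | | |].
    + intros; apply @is_derive_id.
    + intros; apply D0.
    + intros; apply He; lra.
  - replace (3 * t) with (3 * t - 3 * 0) by ring; rewrite <- exp_0.
    apply (is_derive_le exp (fun t => 3 * t) exp (fun _ => 3)); [lra | | |].
    + intros; apply D0.
    + intros; auto_derive; [exact I | ring].
    + intros; apply He; lra. }
assert (D1 : forall t, is_derive (fun t => exp t - 1 - t) t (exp t - 1)).
{ intros t; auto_derive; [exact I | ring]. }
assert (B2 : forall t, 0 <= t <= 1 -> t ^ 2 / 2 <= exp t - 1 - t <= 3 * t ^ 2 / 2).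
{ intros t Ht.
  replace (exp t - 1 - t) with ((exp t - 1 - t) - (exp 0 - 1 - 0)) by (rewrite exp_0; ring).
  split.
  - replace (t ^ 2 / 2) with (t ^ 2 / 2 - 0 ^ 2 / 2) by field.
    apply (is_derive_le (fun t => t ^ 2 / 2) (fun t => exp t - 1 - t) (fun t => t)
      (fun t => exp t - 1)); [lra | | |].
    + intros; auto_derive; [exact I | field].
    + intros; apply D1.
    + intros; apply B1; lra.
  - replace (3 * t ^ 2 / 2) with (3 * t ^ 2 / 2 - 3 * 0 ^ 2 / 2) by field.
    apply (is_derive_le (fun t => exp t - 1 - t) (fun t => 3 * t ^ 2 / 2) (fun t => exp t -
      1) (fun t => 3 * t)); [lra | | |].
    + intros; apply D1.
    + intros; auto_derive; [exact I | field].
    + intros; apply B1; lra. }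
split; [generalize (B2 y Hy); lra|].
replace (exp y - 1 - y - y ^ 2 / 2) with ((exp y - 1 - y - y ^ 2 / 2) - (exp 0 - 1 - 0 -
  0 ^ 2 / 2))
  by (rewrite exp_0; field).
replace (y ^ 3 / 2) with (y ^ 3 / 2 - 0 ^ 3 / 2) by field.
apply (is_derive_le (fun t => exp t - 1 - t - t ^ 2 / 2) (fun t => t ^ 3 / 2)
  (fun t => exp t - 1 - t) (fun t => 3 * t ^ 2 / 2)); [lra | | |].
- intros; auto_derive; [exact I | field].
- intros; auto_derive; [exact I | field].
- intros; apply B2; lra.
Qed.

Lemma exp_second_order_lim (l : R) : 0 < l ->
  right_lim (fun e => (exp (l * e) - 1 - l * e) / e ^ 2) (l ^ 2 / 2).
Proof.
intros Hl; apply filterlim_locally; intros [eps Heps].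
(* [/ l] keeps [l * e] below 1, and [eps / l ^ 3] makes the remainder [e * l^3 / 2] smaller than
   [eps]. *)
set (r := Rmin (/ l) (eps / l ^ 3)).
assert (Hl3 : 0 < l ^ 3) by (apply pow_lt; exact Hl).
assert (Hr : 0 < r).
{ apply Rmin_glb_lt; [apply Rinv_0_lt_compat; exact Hl | apply Rdiv_lt_0_compat; assumption]. }
apply filter_imp with (2 := at_right_0_lt r Hr); intros e He.
assert (H1 : e < / l) by (eapply Rlt_le_trans; [apply He | apply Rmin_l]).
assert (H2 : e < eps / l ^ 3) by (eapply Rlt_le_trans; [apply He | apply Rmin_r]).
apply (Rmult_lt_compat_l l) in H1; [|exact Hl]; rewrite Rinv_r in H1 by lra.
apply (Rmult_lt_compat_r (l ^ 3)) in H2; [|exact Hl3].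
replace (eps / l ^ 3 * l ^ 3) with eps in H2 by (field; lra).
assert (H := exp_taylor_2 (l * e) ltac:(nra)).
assert (He2 : 0 < e ^ 2) by (apply pow_lt; lra).
change (Rabs ((exp (l * e) - 1 - l * e) / e ^ 2 - l ^ 2 / 2) < eps).
replace ((exp (l * e) - 1 - l * e) / e ^ 2 - l ^ 2 / 2) with
  ((exp (l * e) - 1 - l * e - (l * e) ^ 2 / 2) / e ^ 2) by (field; lra).
rewrite Rabs_pos_eq by (apply Rdiv_le_0_compat; lra).
apply Rle_lt_trans with ((l * e) ^ 3 / 2 / e ^ 2).
- apply Rmult_le_compat_r; [left; apply Rinv_0_lt_compat; exact He2 | lra].
- replace ((l * e) ^ 3 / 2 / e ^ 2) with (e * l ^ 3 / 2) by (field; lra).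
  nra.
Qed.

(** Here [l] will be [ln 2]. The multiplier [2 exp (2le) - exp (le)] is
    [1 + 3le + (7/2) l^2 e^2 + ...]: its value 1 at 0 cancels the poles, and its next two
    coefficients are the source of the 6 and the 7 in the theorem. *)
Lemma laurent_coefficients (P Q sg : R -> R) (l P1 Q1 S r : R) :
  0 < l -> 0 < r -> is_derive P 0 P1 -> is_derive Q 0 Q1 -> right_lim sg S ->
  (forall e, 0 < e < r -> / e + P e =
     (2 * exp (2 * l * e) - exp (l * e)) * (/ e + Q e) + 2 * exp (2 * l * e) * (PI / 4 -
       e * sg e)) ->
  P1 = 7 / 2 * l ^ 2 + 3 * l * Q 0 + Q1 + PI * l - 2 * S.
Proof.
intros Hl Hr HP HQ HS HE.
assert (LP : right_lim P (P 0)).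
{ apply right_lim_continuous, (ex_derive_continuous (V := R_NormedModule)); eexists;
  exact HP. }
assert (LQ : right_lim Q (Q 0)).
{ apply right_lim_continuous, (ex_derive_continuous (V := R_NormedModule)); eexists;
  exact HQ. }
assert (LX : right_lim (fun e => 2 * exp (2 * l * e)) 2).
{ apply right_lim_eq with (2 * exp (2 * l * 0)); [rewrite Rmult_0_r, exp_0; ring|].
  apply (right_lim_continuous (fun e => 2 * exp (2 * l * e))).
  apply (ex_derive_continuous (V := R_NormedModule)); auto_derive; exact I. }
assert (Lid : right_lim (fun e => e) 0).
{ apply (right_lim_continuous (fun e => e)), continuous_id. }
assert (Lk : right_lim (fun e => (2 * exp (2 * l * e) - 2) / e) (4 * l)).
{ apply (right_lim_ext (fun e => (2 * exp (2 * l * e) - 2 * exp (2 * l * 0)) / e) _ 1);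
  [lra | |].
  - intros e _; rewrite Rmult_0_r, exp_0; f_equal; ring.
  - apply (right_lim_quotient (fun e => 2 * exp (2 * l * e))).
    auto_derive; [exact I | rewrite Rmult_0_r, exp_0; ring]. }
set (c2 := fun e => (2 * exp (2 * l * e) - exp (l * e) - 1 - 3 * l * e) / e ^ 2).
assert (L2 : right_lim c2 (7 / 2 * l ^ 2)).
{ assert (Hl2 : 0 < 2 * l) by lra.
  assert (A := filterlim_Rminus _ _ _ _
    (filterlim_Rmult _ _ _ _ (filterlim_const 2) (exp_second_order_lim (2 * l) Hl2))
    (exp_second_order_lim l Hl)).
  replace (7 / 2 * l ^ 2) with (2 * ((2 * l) ^ 2 / 2) - l ^ 2 / 2) by field.
  apply right_lim_ext with (3 := A) (r := 1); [lra|].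
  intros e He; unfold c2; field; lra. }
assert (L1 : right_lim (fun e => 3 * l + c2 e * e) (3 * l)).
{ apply right_lim_eq with (3 * l + 7 / 2 * l ^ 2 * 0); [ring|].
  apply filterlim_Rplus; [apply filterlim_const | apply filterlim_Rmult; assumption]. }
assert (Lc : right_lim (fun e => 1 + (3 * l + c2 e * e) * e) 1).
{ apply right_lim_eq with (1 + 3 * l * 0); [ring|].
  apply filterlim_Rplus; [apply filterlim_const | apply filterlim_Rmult; assumption]. }
assert (HE' : forall e, 0 < e < r -> P e = (3 * l + c2 e * e) + (1 + (3 * l + c2 e * e) * e) *
  Q e +
   2 * exp (2 * l * e) * (PI / 4 - e * sg e)).
{ intros e He; specialize (HE e He).
  replace (P e) with (/ e + P e - / e) by ring; rewrite HE; unfold c2; field; lra. }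
(* The value [P 0] enters the difference quotient of [P]; letting [e] tend to 0 in [HE'] supplies
   it. *)
assert (E0 : P 0 = 3 * l + 1 * Q 0 + 2 * (PI / 4 - 0 * S)).
{ apply (right_lim_unique P); [exact LP|].
  apply (right_lim_ext (fun e => (3 * l + c2 e * e) + (1 + (3 * l + c2 e * e) * e) * Q e +
   2 * exp (2 * l * e) * (PI / 4 - e * sg e)) P r); [exact Hr | intros; symmetry; apply HE';
     assumption|].
  repeat first [assumption | apply filterlim_const | apply filterlim_Rminus | apply
    filterlim_Rplus | apply filterlim_Rmult]. }
assert (LPq := right_lim_quotient P P1 HP).
assert (LQq := right_lim_quotient Q Q1 HQ).
replace (7 / 2 * l ^ 2 + 3 * l * Q 0 + Q1 + PI * l - 2 * S) with
  (7 / 2 * l ^ 2 + 3 * l * Q 0 + Q1 + 4 * l * (PI / 4) - 2 * S) by field.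
apply (right_lim_unique _ _ _ LPq).
apply (right_lim_ext (fun e => c2 e + (3 * l + c2 e * e) * Q e + (Q e - Q 0) / e +
  (2 * exp (2 * l * e) - 2) / e * (PI / 4) - 2 * exp (2 * l * e) * sg e) _ r); [exact Hr | |].
- intros e He; rewrite E0, (HE' e He); field; lra.
- repeat first [assumption | apply filterlim_const | apply filterlim_Rminus | apply
  filterlim_Rplus | apply filterlim_Rmult].
Qed.

Theorem mainTheorem3 :
  forall (zeta : R -> C -> C) (stieltjes : R -> nat -> R),
    (forall u : R, 0 < u -> is_hurwitz_zeta u (zeta u)) ->
    (forall u : R, 0 < u -> is_stieltjes (zeta u) (stieltjes u)) ->
    stieltjes (1 / 4) 1%nat =
      1 / 2 * (2 * stieltjes 1 1%nat - 7 * (ln 2) ^ 2 - 6 * euler_gamma * ln 2)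
      - 1 / 2 * PI *
        (euler_gamma + 4 * ln 2 + 3 * ln PI - 4 * ln (Gamma (1 / 4))).
Proof.
intros zeta stieltjes Hz Hs.
assert (HPI := PI_RGT_0).
set (q := fun e => Re (zeta (1 / 4) (RtoC (1 + e)))).
set (z := fun e => Re (zeta 1 (RtoC (1 + e)))).
assert (Hq : forall e, 0 < e -> is_lim_seq (psum (fun n => Rpower (INR n + 1 / 4)
  (- (1 + e)))) (q e)).
{ intros e He; apply is_hurwitz_zeta_real; [apply Hz; lra | lra | exact He]. }
assert (Hz1 : forall e, 0 < e -> is_lim_seq (psum (fun n => Rpower (INR n + 1) (- (1 + e))))
  (z e)).
{ intros e He; apply is_hurwitz_zeta_real; [apply Hz; lra | lra | exact He]. }
destruct (is_stieltjes_real _ _ (Hs (1 / 4) ltac:(lra))) as [r1 [P [Hr1 [HP1 HP2]]]].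
destruct (is_stieltjes_real _ _ (Hs 1 ltac:(lra))) as [r2 [Q [Hr2 [HQ1 HQ2]]]].
(* The decomposition modulo 4, solved for beta at [1 + e]. *)
set (B := fun e => 2 * Rpower 4 (- (1 + e)) * q e - (1 - Rpower 2 (- (1 + e))) * z e).
destruct (beta_derivative_lim B) as [S [HS1 HS2]].
{ intros e He; apply beta_hurwitz; [apply Hq | apply Hz1]; exact He. }
(* [Q] is continuous at 0, so the one-sided limit of the zeta series minus its pole determines
   [Q 0]. *)
assert (HQ0 : Q 0 = euler_gamma).
{ apply (right_lim_unique Q).
  - apply right_lim_continuous, (ex_derive_continuous (V := R_NormedModule)); eexists;
    exact HQ2.
  - apply (right_lim_ext (fun e => z e - / e) Q r2); [exact Hr2 | |].
    + intros e He; unfold z; rewrite HQ1 by exact He; ring.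
    + apply zeta_minus_pole_lim; exact Hz1. }
assert (Hl2 : 0 < ln 2) by (rewrite <- ln_1; apply ln_increasing; lra).
assert (E1 : - stieltjes (1 / 4) 1%nat =
  7 / 2 * ln 2 ^ 2 + 3 * ln 2 * Q 0 + - stieltjes 1 1%nat + PI * ln 2 - 2 * S).
{ apply (laurent_coefficients P Q (fun e => (PI / 4 - B e) / e) _ _ _ _ (Rmin r1 r2));
  try assumption.
  - apply Rmin_glb_lt; assumption.
  - intros e He.
    assert (He1 : 0 < e < r1) by (generalize (Rmin_l r1 r2); lra).
    assert (He2 : 0 < e < r2) by (generalize (Rmin_r r1 r2); lra).
    rewrite <- (HP1 e He1), <- (HQ1 e He2); fold (q e) (z e).
    replace (PI / 4 - e * ((PI / 4 - B e) / e)) with (B e) by (field; lra).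
    unfold B.
    set (X := exp (ln 2 * e)).
    assert (HX : 0 < X) by apply exp_pos.
    assert (EX2 : exp (2 * ln 2 * e) = X * X).
    { unfold X; rewrite <- exp_plus; f_equal; ring. }
    assert (E2 : Rpower 2 (- (1 + e)) = / (2 * X)).
    { rewrite Rpower_Ropp, Rpower_plus, Rpower_1 by lra; f_equal; f_equal.
      unfold Rpower, X; f_equal; ring. }
    assert (E4 : Rpower 4 (- (1 + e)) = / (2 * X) * / (2 * X)).
    { replace 4 with (2 * 2) by ring; rewrite Rpower_base_mult, E2 by lra; reflexivity. }
    rewrite EX2, E2, E4; field; lra. }
(* Two evaluations of the same limit give a linear equation for [S]. *)
assert (D1 := log_quotient_lim S HS1).
assert (D2 := log_quotient_Gamma).
apply is_lim_seq_unique in D1; apply is_lim_seq_unique in D2.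
rewrite D1 in D2; injection D2; clear D1 D2; intros D.
rewrite ln_mult in D by lra.
assert (ES : S = PI / 2 * (2 * ln (Gamma (1 / 4)) - ln PI - ln 2 / 2 -
  (euler_gamma + (ln 2 + ln PI)) / 2)).
{ rewrite <- D; field; lra. }
rewrite HQ0, ES in E1.
lra.
Qed.
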